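(* Let $M$ be a (complete, finite-dimensional) Alexandrov space with a lower curvature bound, with distance $d$, and let $X$ be a random variable on $M$ with distribution $\mathbb{P}^X$ and finite second moments, i.e. $\int_M d(q,x)^2\,d\mathbb{P}^X(x)<\infty$ for one (hence for all) $q\in M$. Let $F:M\to\mathbb{R}$, $F(q)=\int_M d(q,x)^2\,d\mathbb{P}^X(x)$, be the corresponding Fréchet function and let $\mu\in M$ be a Fréchet mean, i.e. a minimizer of $F$. Then the differential $D_\mu F:T_\mu M\to\mathbb{R}$ is the zero map.
   Context: An Alexandrov space with a lower curvature bound is a complete, finite-dimensional length space with curvature $\ge\kappa$ in the sense of Alexandrov (triangle comparison) for some $\kappa\in\mathbb{R}$; its boundary may be non-empty. The tangent cone $T_qM$ at $q\in M$ is the Euclidean cone over the space of directions at $q$, the latter being the metric completion, with respect to angles, of the set of directions of shortest curves starting at $q$. For a locally Lipschitz, semiconcave function $f$ near $q$ (such as $F$), the differential $D_qf:T_qM\to\mathbb{R}$ is the unique continuous, positively $1$-homogeneous map such that $D_qf(\gamma'(0))=\lim_{t\searrow 0}\frac{f(\gamma(t))-f(q)}{t}$ for every unit-speed shortest curve $\gamma$ starting at $q$, where $\gamma'(0)\in T_qM$ is its direction. *)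

(* Defs.v *)
From HB Require Import structures.
From mathcomp Require Import all_boot all_order all_algebra.
From mathcomp Require Import all_classical all_reals all_analysis.
From mathcomp Require Import ring.

Set Implicit Arguments.
Unset Strict Implicit.
Unset Printing Implicit Defensive.

Import Order.TTheory GRing.Theory Num.Theory.
Import numFieldNormedType.Exports.

Local Open Scope classical_set_scope.
Local Open Scope ring_scope.

#[short(type="completeMetricType")]
HB.structure Definition CompleteMetric (K : numFieldType) :=
  { M of CompletePseudoMetric K M & Metric K M }.

(** The underlying space with its Borel sigma-algebra. *)
Notation borel M := (g_sigma_algebraType (@open M)).

Section alexandrov_spaces.
Context {R : realType} (M : metricType R).

Definition curve_length (a b : R) (g : R -> M) : \bar R :=
  ereal_sup [set (\sum_(0 <= i < size s)
                    mdist (g (nth b (a :: s) i)) (g (nth b (a :: s) i.+1)))%:E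
            | s in itv_partition a b].

Definition length_space : Prop := forall x y : M,
  (mdist x y)%:E =
  ereal_inf [set curve_length 0 1 g | g in
    [set g : R -> M |
      [/\ {within `[0, 1], continuous g}, g 0 = x & g 1 = y]]].

(** Shortest curves are parametrized by arc length; a curve is only meaningful
    on [0, l], the values of [g] outside play no role. *)
Definition shortest_curve (l : R) (g : R -> M) : Prop :=
  0 <= l /\
  forall s t, s \in `[0, l] -> t \in `[0, l] -> mdist (g s) (g t) = `|s - t|.

(** Finite dimension is understood through the rough dimension of Burago,
    Gromov and Perelman (growth of the cardinality of e-separated subsets of
    bounded sets as e -> 0).  For complete length spaces with a lower curvature
    bound it coincides with the Hausdorff dimension, the topological dimension
    and the strainer number.  It makes closed balls compact, so that shortest
    curves exist and the triangle comparison below is not vacuous. *)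
Definition separated (e : R) (A : set M) (s : seq M) : Prop :=
  [/\ uniq s, (forall x, x \in s -> A x) &
      forall x y, x \in s -> y \in s -> x != y -> e <= mdist x y].

Definition rough_dim_le (n : nat) (A : set M) : Prop :=
  exists C : R, forall (e : R) (s : seq M),
    0 < e <= 1 -> separated e A s -> (size s)%:R * e ^+ n <= C.

Definition finite_dimensional : Prop :=
  exists n : nat, forall (x : M) (r : R), rough_dim_le n (ball x r).

End alexandrov_spaces.

Section model_plane.
Context {R : realType}.
Implicit Types (k s t c theta : R).

Definition cosh (x : R) : R := (expR x + expR (- x)) / 2.
Definition sinh (x : R) : R := (expR x - expR (- x)) / 2.

Definition law_of_cosines k s t theta c : Prop :=
  let w := Num.sqrt `|k| in
  if k == 0 then
    c ^+ 2 = s ^+ 2 + t ^+ 2 - 2 * s * t * cos theta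
  else if 0 < k then
    cos (w * c) = cos (w * s) * cos (w * t)
                  + sin (w * s) * sin (w * t) * cos theta
  else
    cosh (w * c) = cosh (w * s) * cosh (w * t)
                   - sinh (w * s) * sinh (w * t) * cos theta.

(** In the simply connected surface of constant curvature [k], two shortest
    curves of lengths [s] and [t] issuing from a common point at angle [theta]
    have their endpoints at distance [c]. *)
Definition model_hinge k s t theta c : Prop :=
  [/\ 0 <= theta <= pi, 0 <= c, (0 < k -> Num.sqrt k * c <= pi) &
      law_of_cosines k s t theta c].

End model_plane.

Section curvature.
Context {R : realType} (M : metricType R).

(** Point-on-a-side comparison for the triangles with vertices in [U].  In the
    comparison triangle of [a], [b], [c], whose angle at the vertex
    corresponding to [a] is [theta], the point corresponding to [g u] lies at
    distance [ell] from the vertex corresponding to [b]. *)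
Definition triangle_comparison (k : R) (U : set M) : Prop :=
  forall (a b c : M) (g : R -> M) (u theta ell : R),
    U a -> U b -> U c ->
    shortest_curve (mdist a c) g -> g 0 = a -> g (mdist a c) = c ->
    u \in `[0, mdist a c] ->
    model_hinge k (mdist a b) (mdist a c) theta (mdist b c) ->
    model_hinge k (mdist a b) u theta ell ->
    ell <= mdist b (g u).

(** The comparison is local; for complete spaces it is equivalent to the global
    one by Toponogov's globalization theorem.  Since the radius may be taken small, no separate
    bound on the perimeter of the triangles is needed when [0 < k]. *)
Definition curvature_ge (k : R) : Prop :=
  forall p : M, exists2 r : R, 0 < r & triangle_comparison k (ball p r).

(** Completeness is carried by the type of [M] in [completeMetricType]. *)
Definition alexandrov_space : Prop :=
  [/\ length_space M, finite_dimensional M & exists k : R, curvature_ge k].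

End curvature.

(** Completion of a pseudometric [d], as classes of Cauchy sequences; points at
    distance 0 are identified in the process. *)
Section completion.
Context {R : realType} (T : Type) (d : T -> T -> R).

Definition cauchy_seq (u : nat -> T) : Prop :=
  forall e : R, 0 < e ->
    exists N, forall m n, (N <= m)%N -> (N <= n)%N -> d (u m) (u n) < e.

Definition seq_dist (u v : nat -> T) : R := limn (fun n => d (u n) (v n)).

Definition cauchy_class (u : nat -> T) : set (nat -> T) :=
  [set v | cauchy_seq v /\ seq_dist u v = 0].

Definition completion : Type :=
  {A : set (nat -> T) | exists u, cauchy_seq u /\ A = cauchy_class u}.

Definition completion_repr (A : completion) : nat -> T :=
  proj1_sig (cid (proj2_sig A)).

Definition completion_dist (A B : completion) : R :=
  seq_dist (completion_repr A) (completion_repr B).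

Lemma cauchy_seq_cst (dxx : forall x, d x x = 0) (x : T) :
  cauchy_seq (fun=> x).
Proof. by move=> e e0; exists 0%N => m n _ _; rewrite dxx. Qed.

Definition to_completion (dxx : forall x, d x x = 0) (x : T) : completion :=
  exist _ (cauchy_class (fun=> x))
    (ex_intro _ (fun=> x) (conj (cauchy_seq_cst dxx x) erefl)).

End completion.

Section euclidean_cone.
Context {R : realType} (S : Type).

Inductive cone : Type :=
| apex : cone
| ray : {posnum R} -> S -> cone.

Definition cone_dist (d : S -> S -> R) (v w : cone) : R :=
  match v, w with
  | apex, apex => 0
  | apex, ray t _ => t%:num
  | ray s _, apex => s%:num
  | ray s x, ray t y =>
      Num.sqrt (s%:num ^+ 2 + t%:num ^+ 2
                - 2 * s%:num * t%:num * cos (Num.min (d x y) pi))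
  end.

Definition cone_scale (l : {posnum R}) (v : cone) : cone :=
  match v with
  | apex => apex
  | ray t x => ray (l%:num * t%:num)%:pos x
  end.

End euclidean_cone.
Arguments cone R S : clear implicits.
Arguments apex {R S}.

Section tangent_cone.
Context {R : realType} {M : metricType R}.

Record shortest_from (q : M) : Type := ShortestFrom {
  curve_of :> R -> M ;
  curve_len : R ;
  curve_len_gt0 : 0 < curve_len ;
  curve_at0 : curve_of 0 = q ;
  curve_shortest : shortest_curve curve_len curve_of
}.

Definition comparison_angle (q x y : M) : R :=
  acos ((mdist q x ^+ 2 + mdist q y ^+ 2 - mdist x y ^+ 2)
        / (2 * mdist q x * mdist q y)).

Definition angle (q : M) (g h : shortest_from q) : R :=
  lim (comparison_angle q (g st.1) (h st.2) @[st --> (0^'+, 0^'+)]).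

Lemma anglexx (q : M) (g : shortest_from q) : angle g g = 0.
Proof.
have l0 := curve_len_gt0 g; have g0 := curve_at0 g.
have [_ gE] := curve_shortest g; move: (curve_len g) l0 gE => l l0 gE.
rewrite /angle; apply/cvg_lim; first exact: Rhausdorff.
apply: cvg_near_cst.
exists ([set s | 0 < s <= l], [set s | 0 < s <= l]).
  by split; near=> s; apply/andP; split; near: s;
    [exact: nbhs_right_gt | exact: nbhs_right_le
    |exact: nbhs_right_gt | exact: nbhs_right_le].
move=> [s t] /= [/andP[s0 sl] /andP[t0 tl]].
have sI : s \in `[0, l] by rewrite in_itv /= sl ltW.
have tI : t \in `[0, l] by rewrite in_itv /= tl ltW.
have OI : 0 \in `[0, l] by rewrite in_itv /= lexx ltW.
rewrite /comparison_angle.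
have -> : mdist q (g s) = s.
  by rewrite -[X in mdist X _]g0 gE// sub0r normrN gtr0_norm.
have -> : mdist q (g t) = t.
  by rewrite -[X in mdist X _]g0 gE// sub0r normrN gtr0_norm.
rewrite gE// real_normK ?num_real//.
have -> : s ^+ 2 + t ^+ 2 - (s - t) ^+ 2 = 2 * s * t by ring.
by rewrite divff ?acos1// !mulf_neq0// gt_eqF.
Unshelve. all: by end_near. Qed.

Definition space_of_directions (q : M) : Type := completion (@angle q).

Definition direction (q : M) (g : shortest_from q) : space_of_directions q :=
  to_completion (@anglexx q) g.

Definition tangent_cone (q : M) : Type := cone R (space_of_directions q).

Definition tangent_dist (q : M) : tangent_cone q -> tangent_cone q -> R :=
  cone_dist (@completion_dist R _ (@angle q)).

Definition velocity (q : M) (g : shortest_from q) : tangent_cone q :=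
  ray 1%:pos (direction g).

Definition tangent_continuous (q : M) (D : tangent_cone q -> R) : Prop :=
  forall (v : tangent_cone q) (e : R), 0 < e ->
    exists2 r : R, 0 < r &
      forall w, tangent_dist v w < r -> `|D v - D w| < e.

Definition positively_homogeneous (q : M) (D : tangent_cone q -> R) : Prop :=
  forall (l : {posnum R}) v, D (cone_scale l v) = l%:num * D v.

Definition is_differential (f : M -> R) (q : M) : (tangent_cone q -> R) -> Prop :=
  unique (fun D : tangent_cone q -> R =>
    [/\ tangent_continuous D, positively_homogeneous D &
        forall g : shortest_from q,
          (f (g t) - f q) / t @[t --> 0^'+] --> D (velocity g)]).

End tangent_cone.

Section frechet_means.
Context {R : realType} {M : completeMetricType R} (Q : probability (borel M) R).

Definition finite_second_moment : Prop :=
  exists q : M, (\int[Q]_x (mdist q x ^+ 2)%:E < +oo)%E.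

Definition frechet_function (q : M) : R := \int[Q]_x (mdist q x ^+ 2).

Definition frechet_mean (m : M) : Prop :=
  forall q : M, frechet_function m <= frechet_function q.

End frechet_means.

(* Main.v *)
Require Import Defs.
From HB Require Import structures.
From mathcomp Require Import all_boot all_order all_algebra.
From mathcomp Require Import all_classical all_reals all_analysis.
From mathcomp Require Import measurable_realfun.
From mathcomp Require Import ring lra.

(** Let [F] be the Frechet function.  The differential vanishes because no rate
    of growth of [F] at its minimizer [mu] can be positive.

    Let [s] be the upper limit of [(F y - F mu) / d(mu, y)] as [y] tends to
    [mu], and suppose [s > 0].  Squared distances are semiconcave along short
    segments near [mu] (for remote points as well, [sq_dist_semiconcave]), hence
    so is [F], and there is a shortest curve [w] from [mu] along which [F] grows
    at a rate close to [s] ([steep_geodesic]).  Let [u] be a shortest curve from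
    [mu] to an arbitrary point [x].  If [w] and [u] made an angle definitely
    greater than [pi / 2], the midpoint of [w t] and [u (c * t)] would be
    definitely closer to [mu] than [t / 2] for a suitable [c], while by
    semiconcavity and [F (u (c * t)) >= F mu] the value of [F] there would exceed
    [F mu] by about [s * t / 2]: a rate definitely greater than [s]
    ([steep_acute]).  So every [u] makes an angle of at most about [pi / 2] with
    [w].  By the first variation inequality [d(w t, x)] then exceeds [d(mu, x)]
    by at most a small multiple of [t], and by dominated convergence the rate of
    growth of [F] along [w] is small, a contradiction
    ([frechet_mean_no_slope]).  This is the argument which shows that a concave
    homogeneous function on a cone has a gradient, carried out with points of
    the space instead of tangent vectors.

    Three facts on Alexandrov spaces are needed.  Comparison with a model plane
    is, in small triangles, the Euclidean comparison up to a factor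
    [1 + O(size ^ 2)] ([triangle_comparison_almost_euclidean]), so that one
    inequality serves all curvature bounds, and no globalization is needed
    because every comparison is made close to [mu].  Shortest curves exist: they
    are ultralimits of almost shortest ones ([shortest_curve_exists]).  Angles
    exist as limits and satisfy the triangle inequality ([comparison_cos_cvg],
    [angle_triangle]); the latter makes directions of shortest curves dense in
    their completion, so that a continuous homogeneous function vanishing on all
    velocities is zero ([differential_eq0]), which is the uniqueness of the
    differential. *)

Set Implicit Arguments.
Unset Strict Implicit.
Unset Printing Implicit Defensive.

Import Order.TTheory GRing.Theory Num.Theory.
Import numFieldNormedType.Exports.

Local Open Scope classical_set_scope.
Local Open Scope ring_scope.

(** * Trigonometric and hyperbolic inequalities *)

Section trigonometry.
Context {R : realType}.
Implicit Types (x u v lam : R).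

Lemma derive_ge0_le (f df : R -> R) (a b : R) : a <= b ->
  (forall x, is_derive x 1 f (df x)) ->
  (forall x, a <= x <= b -> 0 <= df x) -> f a <= f b.
Proof.
move=> ab fdf df0; rewrite -subr_ge0.
have fc : {within `[a, b], continuous f}.
  apply: continuous_subspaceT => x.
  apply/differentiable_continuous/derivable1_diffP.
  exact: (@ex_derive _ _ _ _ _ _ _ (fdf x)).
have [c cab ->] := MVT_segment ab (fun x _ => fdf x) fc.
by rewrite mulr_ge0 ?subr_ge0// df0//; rewrite in_itv/= in cab.
Qed.

Lemma derive_le0_ge (f df : R -> R) (a b : R) : a <= b ->
  (forall x, is_derive x 1 f (df x)) ->
  (forall x, a <= x <= b -> df x <= 0) -> f b <= f a.
Proof.
move=> ab fdf df0; rewrite -lerN2.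
apply: (@derive_ge0_le (- f) (fun x => - df x) _ _ ab) => x.
by move=> /df0; rewrite oppr_ge0.
Qed.

Lemma sin_le_id x : 0 <= x -> sin x <= x.
Proof.
move=> x0; have := @derive_ge0_le (fun t => t - sin t) (fun t => 1 - cos t) 0 x x0.
rewrite sin0 subrr subr_ge0; apply => t _.
by rewrite subr_ge0 cos_le1.
Qed.

Lemma normr_sin_le x : 0 <= x -> `|sin x| <= x.
Proof.
move=> x0; rewrite ler_norml sin_le_id// andbT lerNl -subr_ge0 opprK.
have := @derive_ge0_le (fun t => t + sin t) (fun t => 1 + cos t) 0 x x0.
rewrite sin0 addr0; apply => t _.
by rewrite -lerBlDl sub0r cos_geN1.
Qed.

Lemma cos_ge_quad x : 0 <= x -> 1 - x ^+ 2 / 2 <= cos x.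
Proof.
move=> x0.
have := @derive_ge0_le (fun t => cos t - (1 - t ^+ 2 / 2))
  (fun t => - sin t + t) 0 x x0.
rewrite cos0 expr0n/= mul0r subr0 subrr subr_ge0; apply => t.
  by apply: is_derive_eq; rewrite /GRing.scale/=; field.
by move=> /andP[t0 _]; have := sin_le_id t0; lra.
Qed.

Lemma cos_nincr x y : 0 <= x -> x <= y -> y <= pi -> cos y <= cos x.
Proof.
move=> x0 xy ypi; rewrite leNgt ltr_cos -?leNgt//.
  by rewrite in_itv/= ypi (le_trans x0).
by rewrite in_itv/= x0 (le_trans xy).
Qed.

(** That is, [sin x / x] decreases up to [pi]. *)
Lemma sin_star lam x : 0 <= lam <= 1 -> 0 <= x <= pi ->
  lam * sin x <= sin (lam * x).
Proof.
move=> /andP[l0 l1] /andP[x0 xpi].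
have := @derive_ge0_le (fun t => sin (lam * t) - lam * sin t)
  (fun t => lam * (cos (lam * t) - cos t)) 0 x x0.
rewrite mulr0 sin0 mulr0 subrr subr_ge0; apply => t.
  by apply: is_derive_eq; rewrite /GRing.scale/=; ring.
move=> /andP[t0 tx]; have tpi := le_trans tx xpi.
by rewrite mulr_ge0// subr_ge0 cos_nincr ?mulr_ge0// ler_piMl.
Qed.

(** That is, [sin x / x + x ^ 2 / 6] increases. *)
Lemma sin_star_defect lam x : 0 <= lam <= 1 -> 0 <= x ->
  sin (lam * x) - lam * sin x <= lam * (1 - lam ^+ 2) * x ^+ 3 / 6.
Proof.
move=> /andP[l0 l1] x0; rewrite -subr_ge0.
have := @derive_ge0_le
  (fun t => lam * (1 - lam ^+ 2) * t ^+ 3 / 6 - (sin (lam * t) - lam * sin t))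
  (fun t => lam * ((1 - lam ^+ 2) * t ^+ 2 / 2 - (cos (lam * t) - cos t))) 0 x x0.
rewrite expr0n/= !(mulr0, mul0r) sin0 mulr0 !subrr; apply => t.
  by apply: is_derive_eq; rewrite /GRing.scale/=; field.
move=> /andP[t0 tx]; rewrite mulr_ge0// subr_ge0.
pose a := (1 - lam) / 2 * t; pose b := (1 + lam) / 2 * t.
have a0 : 0 <= a by rewrite mulr_ge0//; lra.
have b0 : 0 <= b by rewrite mulr_ge0//; lra.
have -> : lam * t = b - a by rewrite /a /b; field.
have -> : cos t = cos (b + a) by congr cos; rewrite /a /b; field.
rewrite cosB cosD.
have -> : (1 - lam ^+ 2) * t ^+ 2 / 2 = 2 * (b * a) by rewrite /a /b; field.
have sab : sin b * sin a <= b * a.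
  by rewrite (le_trans (ler_norm _))// normrM ler_pM// normr_sin_le.
lra.
Qed.

(** As a function of [v ^ 2] the cosine has second derivative at most [1 / 12];
    the right-hand side is the corresponding parabola touching its graph at
    [u ^ 2].  Tangent lines bound it on the wrong side for spherical comparison,
    and the second order term is what has to be paid for that. *)
Lemma cos_le_tangent u v : 0 < u -> 0 <= v ->
  cos v <= cos u - (v ^+ 2 - u ^+ 2) * (sin u / (2 * u))
           + (v ^+ 2 - u ^+ 2) ^+ 2 / 24.
Proof.
move=> u0 v0.
pose h (t : R) : R := cos u - (t ^+ 2 - u ^+ 2) * (sin u / (2 * u))
           + (t ^+ 2 - u ^+ 2) ^+ 2 / 24 - cos t.
pose dh (t : R) : R := sin t - t * (sin u / u) + t * (t ^+ 2 - u ^+ 2) / 6.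
have un0 : u != 0 by rewrite gt_eqF.
have hdh (t : R) : is_derive (t : R) (1 : R) h (dh t).
  by rewrite /h /dh; apply: is_derive_eq; rewrite /GRing.scale/=; field.
have hu : h u = 0 by rewrite /h; ring.
rewrite -subr_ge0 -/(h v) -hu.
have [uv|/ltW vu] := leP u v.
  apply: (derive_ge0_le uv hdh) => t /andP[ut tv].
  have t0 : 0 < t by exact: lt_le_trans ut.
  have tn0 : t != 0 by rewrite gt_eqF.
  have l01 : 0 <= u / t <= 1 by rewrite divr_ge0 ?(ltW u0) ?(ltW t0)//= ler_pdivrMr// mul1r.
  have := sin_star_defect l01 (ltW t0).
  rewrite divfK// -(ler_pM2l (divr_gt0 t0 u0)) mulrBr.
  have -> : t / u * (u / t * sin t) = sin t by field; rewrite tn0.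
  have -> : t / u * (u / t * (1 - (u / t) ^+ 2) * t ^+ 3 / 6) = t * (t ^+ 2 - u ^+ 2) / 6.
    by field; rewrite tn0.
  rewrite /dh; have -> : t / u * sin u = t * (sin u / u) by ring.
  lra.
apply: (derive_le0_ge vu hdh) => t /andP[vt tu].
have l01 : 0 <= t / u <= 1.
  by rewrite divr_ge0 ?(ltW u0) ?(le_trans v0)//= ler_pdivrMr// mul1r.
have := sin_star_defect l01 (ltW u0).
rewrite divfK//.
have -> : t / u * (1 - (t / u) ^+ 2) * u ^+ 3 / 6 = t * (u ^+ 2 - t ^+ 2) / 6.
  by field.
rewrite /dh; have -> : t / u * sin u = t * (sin u / u) by ring.
lra.
Qed.

Lemma cosh0 : cosh 0 = 1 :> R.
Proof. by rewrite /cosh oppr0 expR0; field. Qed.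

Lemma sinh0 : sinh 0 = 0 :> R.
Proof. by rewrite /sinh oppr0 expR0; field. Qed.

Lemma is_derive_cosh x : is_derive x 1 (@cosh R) (sinh x).
Proof.
by rewrite /cosh /sinh; apply: is_derive_eq; rewrite /GRing.scale/=; field.
Qed.

Lemma is_derive_sinh x : is_derive x 1 (@sinh R) (cosh x).
Proof.
by rewrite /cosh /sinh; apply: is_derive_eq; rewrite /GRing.scale/=; field.
Qed.

Local Existing Instance is_derive_cosh.
Local Existing Instance is_derive_sinh.

Lemma coshD x y : cosh (x + y) = cosh x * cosh y + sinh x * sinh y :> R.
Proof. by rewrite /cosh /sinh opprD !expRD; field. Qed.

Lemma sinhD x y : sinh (x + y) = sinh x * cosh y + cosh x * sinh y :> R.
Proof. by rewrite /cosh /sinh opprD !expRD; field. Qed.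

Lemma coshN x : cosh (- x) = cosh x :> R.
Proof. by rewrite /cosh opprK addrC. Qed.

Lemma sinhN x : sinh (- x) = - sinh x :> R.
Proof. by rewrite /sinh opprK -mulNr opprB. Qed.

Lemma cosh2sinh2 x : cosh x ^+ 2 - sinh x ^+ 2 = 1 :> R.
Proof.
rewrite /cosh /sinh; have : expR x * expR (- x) = 1 by rewrite -expRD subrr expR0.
by move=> e; rewrite -[RHS]e; field.
Qed.

Lemma sinh_ge0 x : 0 <= x -> 0 <= sinh x :> R.
Proof.
by move=> x0; rewrite /sinh divr_ge0// subr_ge0 ler_expR; lra.
Qed.

Lemma sinh_gt0 x : 0 < x -> 0 < sinh x :> R.
Proof.
by move=> x0; rewrite /sinh divr_gt0// subr_gt0 ltr_expR; lra.
Qed.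

Lemma cosh_ge1 x : 1 <= cosh x :> R.
Proof.
have := cosh2sinh2 x; have : 0 <= cosh x :> R by rewrite /cosh divr_ge0// addr_ge0 ?expR_ge0.
by move: (cosh x) (sinh x) => c s; nra.
Qed.

Lemma cosh_ndecr x y : 0 <= x -> x <= y -> cosh x <= cosh y :> R.
Proof.
move=> x0 xy; apply: (derive_ge0_le xy is_derive_cosh) => t /andP[xt _].
by rewrite sinh_ge0// (le_trans x0).
Qed.

(** That is, [sinh x / x] increases. *)
Lemma sinh_star lam x : 0 <= lam <= 1 -> 0 <= x ->
  sinh (lam * x) <= lam * sinh x :> R.
Proof.
move=> /andP[l0 l1] x0.
have := @derive_ge0_le (fun t => lam * sinh t - sinh (lam * t))
  (fun t => lam * (cosh t - cosh (lam * t))) 0 x x0.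
rewrite mulr0 sinh0 mulr0 subrr subr_ge0; apply => t.
  by apply: is_derive_eq; rewrite /GRing.scale/=; ring.
move=> /andP[t0 tx].
by rewrite mulr_ge0// subr_ge0 cosh_ndecr ?mulr_ge0// ler_piMl.
Qed.

End trigonometry.

(** * Triangle comparison is Euclidean up to second order *)

Section almost_euclidean.
Context {R : realType}.
Implicit Types (x u v lam eta : R).

Local Existing Instance is_derive_cosh.
Local Existing Instance is_derive_sinh.

Lemma sinh_ge_id x : 0 <= x -> x <= sinh x.
Proof.
move=> x0; have := @derive_ge0_le R (fun t => sinh t - t) (fun t => cosh t - 1) 0 x x0.
rewrite sinh0 subrr subr_ge0; apply => t _.
by rewrite subr_ge0 cosh_ge1.
Qed.

Lemma sinh_le_cosh x : 0 <= x -> sinh x <= x * cosh x.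
Proof.
move=> x0; have := @derive_ge0_le R (fun t => t * cosh t - sinh t)
  (fun t => t * sinh t) 0 x x0.
rewrite sinh0 mul0r subrr subr_ge0; apply => t.
  by apply: is_derive_eq; rewrite /GRing.scale/=; ring.
by move=> /andP[t0 _]; rewrite mulr_ge0// sinh_ge0.
Qed.

Lemma sin_ge_cubic x : 0 <= x -> x - x ^+ 3 / 6 <= sin x.
Proof.
move=> x0; have := @derive_ge0_le R (fun t => sin t - (t - t ^+ 3 / 6))
  (fun t => cos t - (1 - t ^+ 2 / 2)) 0 x x0.
rewrite sin0 expr0n/= !(mul0r, subrr, subr0) subr_ge0; apply => t.
  by apply: is_derive_eq; rewrite /GRing.scale/=; field.
by move=> /andP[t0 _]; rewrite subr_ge0 cos_ge_quad.
Qed.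

(** The hyperbolic cosine is a convex function of the square of its argument;
    this is its tangent line at [u ^ 2]. *)
Lemma cosh_ge_tangent u v : 0 < u -> 0 <= v ->
  cosh u + (v ^+ 2 - u ^+ 2) * (sinh u / (2 * u)) <= cosh v.
Proof.
move=> u0 v0.
pose h (t : R) : R := cosh t - (cosh u + (t ^+ 2 - u ^+ 2) * (sinh u / (2 * u))).
pose dh (t : R) : R := sinh t - t * (sinh u / u).
have un0 : u != 0 by rewrite gt_eqF.
have hdh (t : R) : is_derive (t : R) (1 : R) h (dh t).
  by rewrite /h /dh; apply: is_derive_eq; rewrite /GRing.scale/=; field.
have hu : h u = 0 by rewrite /h; ring.
rewrite -subr_ge0 -/(h v) -hu.
have [uv|/ltW vu] := leP u v.
  apply: (derive_ge0_le uv hdh) => t /andP[ut tv].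
  have t0 : 0 < t by exact: lt_le_trans ut.
  have tn0 : t != 0 by rewrite gt_eqF.
  have l01 : 0 <= u / t <= 1.
    by rewrite divr_ge0 ?(ltW u0) ?(ltW t0)//= ler_pdivrMr// mul1r.
  have := sinh_star l01 (ltW t0).
  rewrite divfK// -(ler_pM2l (divr_gt0 t0 u0)).
  have -> : t / u * (u / t * sinh t) = sinh t by field; rewrite tn0.
  by rewrite /dh subr_ge0; have -> : t / u * sinh u = t * (sinh u / u) by ring.
apply: (derive_le0_ge vu hdh) => t /andP[vt tu].
have l01 : 0 <= t / u <= 1.
  by rewrite divr_ge0 ?(ltW u0) ?(le_trans v0)//= ler_pdivrMr// mul1r.
have := sinh_star l01 (ltW u0).
rewrite divfK// /dh subr_le0.
by have -> : t / u * sinh u = t * (sinh u / u) by ring.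
Qed.

(** Here [x] is the length of a side, [v1] and [v2] are the distances of its
    ends from the opposite vertex and [u] is that of the point dividing the side
    in the ratio [lam : 1 - lam].  The last hypothesis is what remains of
    hyperbolic comparison when the angle is eliminated from the two laws of
    cosines.  The tangent lines of [cosh] in the squared variable give the left
    side, and the defect [sinh x - sinh ((1 - lam) * x) - sinh (lam * x)], a
    product of three hyperbolic sines, gives the right side. *)
Lemma hyperbolic_almost_euclidean lam x u v1 v2 eta :
  0 <= lam <= 1 -> 0 < x -> x <= 2 * eta -> 0 < u ->
  0 <= v1 <= eta -> 0 <= v2 <= eta ->
  sinh ((1 - lam) * x) * cosh v1 + sinh (lam * x) * cosh v2 <= sinh x * cosh u ->
  (1 - lam) * v1 ^+ 2 + lam * v2 ^+ 2 - u ^+ 2 <=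
    cosh eta ^+ 2 * (lam * (1 - lam) * x ^+ 2).
Proof.
move=> /andP[l0 l1] x0 xeta u0 /andP[v10 v1e] /andP[v20 v2e] H.
have eta0 : 0 <= eta by exact: le_trans v1e.
have m0 : 0 <= 1 - lam by rewrite subr_ge0.
have lm0 : 0 <= lam * (1 - lam) by rewrite mulr_ge0.
set D := _ - u ^+ 2.
have [D0|D0] := leP D 0.
  by rewrite (le_trans D0)// mulr_ge0 ?sqr_ge0// mulr_ge0// sqr_ge0.
pose S := sinh u / (2 * u).
have S12 : 2^-1 <= S.
  rewrite /S ler_pdivlMr ?mulr_gt0//.
  have -> : 2^-1 * (2 * u) = u by field.
  exact: sinh_ge_id (ltW u0).
pose h := sinh (x / 2); pose C := cosh (x / 2).
have x20 : 0 < x / 2 by rewrite divr_gt0.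
have h0 : 0 < h by exact: sinh_gt0.
have C1 : 1 <= C by exact: cosh_ge1.
have Ceta : C <= cosh eta by apply: cosh_ndecr; lra.
have e1 : 1 <= cosh eta by exact: cosh_ge1.
have X2 : sinh x = 2 * h * C by rewrite [in LHS](splitr x) sinhD /h /C; ring.
pose a := sinh (lam * (x / 2)); pose b := sinh ((1 - lam) * (x / 2)).
have a0 : 0 <= a by apply: sinh_ge0; rewrite mulr_ge0// ltW.
have b0 : 0 <= b by apply: sinh_ge0; rewrite mulr_ge0// ltW.
have al : a <= lam * h by apply: sinh_star; rewrite ?l0// ltW.
have bl : b <= (1 - lam) * h by apply: sinh_star; [rewrite m0/=; lra | exact: ltW].
have defect : sinh x - sinh ((1 - lam) * x) - sinh (lam * x) = 4 * h * (a * b).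
  pose p := lam * (x / 2); pose q := (1 - lam) * (x / 2).
  have -> : sinh x = sinh ((p + q) + (p + q)) by congr sinh; rewrite /p /q; field.
  have -> : sinh ((1 - lam) * x) = sinh (q + q) by congr sinh; rewrite /q; field.
  have -> : sinh (lam * x) = sinh (p + p) by congr sinh; rewrite /p; field.
  have -> : h = sinh (p + q) by congr sinh; rewrite /p /q; field.
  rewrite /a /b -/p -/q /sinh !opprD !expRD !expRN.
  by field; rewrite !gt_eqF ?expR_gt0.
have P0 : 0 <= lam * (1 - lam) * h ^+ 2 by rewrite mulr_ge0 ?sqr_ge0.
have hx : h ^+ 2 <= (x / 2 * C) ^+ 2.
  have hh : h <= x / 2 * C by apply: sinh_le_cosh; exact: ltW.
  by rewrite ler_sqr// nnegrE ?(le_trans _ hh) ?ltW.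
have main : C * (S * D) <= 2 * (lam * (1 - lam) * h ^+ 2) * cosh eta.
  have T1 := cosh_ge_tangent u0 v10; have T2 := cosh_ge_tangent u0 v20.
  rewrite -/S in T1 T2.
  have s1 : sinh ((1 - lam) * x) <= (1 - lam) * sinh x.
    by apply: sinh_star (ltW x0); rewrite m0/=; lra.
  have s2 : sinh (lam * x) <= lam * sinh x.
    by apply: sinh_star (ltW x0); rewrite l0.
  have c1 := cosh_ndecr v10 v1e; have c2 := cosh_ndecr v20 v2e.
  have g1 : ((1 - lam) * sinh x - sinh ((1 - lam) * x)) * cosh v1 <=
            ((1 - lam) * sinh x - sinh ((1 - lam) * x)) * cosh eta.
    by rewrite ler_wpM2l ?subr_ge0.
  have g2 : (lam * sinh x - sinh (lam * x)) * cosh v2 <=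
            (lam * sinh x - sinh (lam * x)) * cosh eta.
    by rewrite ler_wpM2l ?subr_ge0.
  have X0 : 0 <= sinh x by rewrite sinh_ge0// ltW.
  have t1 := ler_wpM2l (mulr_ge0 X0 m0) T1.
  have t2 := ler_wpM2l (mulr_ge0 X0 l0) T2.
  have key : sinh x * (S * D) <= (sinh x - sinh ((1 - lam) * x) - sinh (lam * x)) * cosh eta.
    by rewrite /D; clear -H t1 t2 g1 g2; lra.
  have ab : a * b <= lam * (1 - lam) * h ^+ 2.
    by rewrite (le_trans (ler_pM a0 b0 al bl))// le_eqVlt; apply/orP; left; apply/eqP; ring.
  have key2 : 2 * h * (C * (S * D)) <= 2 * h * (2 * (lam * (1 - lam) * h ^+ 2) * cosh eta).
    rewrite defect X2 in key.
    have := ler_wpM2l (mulr_ge0 (mulr_ge0 (ler0n R 4) (ltW h0)) (le_trans ler01 e1)) ab.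
    by lra.
  by move: key2; rewrite ler_pM2l // mulr_gt0.
have C0 : 0 < C by exact: lt_le_trans ltr01 C1.
have main2 : C * (S * D) <= C * (lam * (1 - lam) * x ^+ 2 / 2 * (C * cosh eta)).
  apply: (le_trans main).
  have := ler_wpM2l (mulr_ge0 lm0 (le_trans ler01 e1)) hx.
  rewrite expr_div_n exprMn.
  lra.
rewrite ler_pM2l// in main2.
have SD : 2^-1 * D <= S * D by rewrite ler_pM2r.
have Ce : C * cosh eta <= cosh eta ^+ 2.
  by rewrite expr2 ler_pM2r// (lt_le_trans ltr01).
have := ler_wpM2l (mulr_ge0 lm0 (sqr_ge0 x)) Ce.
lra.
Qed.

(** The spherical analogue.  Its second order error is controlled by
    [`|v1 - u|] and [`|v2 - u|], hence by the triangle inequality; this is what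
    keeps the factor [lam * (1 - lam)]. *)
Lemma spherical_almost_euclidean lam x u v1 v2 eta :
  0 <= lam <= 1 -> 0 < x -> eta <= 2^-1 ->
  0 < u <= eta -> 0 <= v1 <= eta -> 0 <= v2 <= eta ->
  x <= 2 * eta -> `|v1 - u| <= lam * x -> `|v2 - u| <= (1 - lam) * x ->
  sin x * cos u <= sin ((1 - lam) * x) * cos v1 + sin (lam * x) * cos v2 ->
  (1 - lam) * v1 ^+ 2 + lam * v2 ^+ 2 - u ^+ 2 <=
    (1 + 3 * eta ^+ 2) * (lam * (1 - lam) * x ^+ 2).
Proof.
move=> /andP[l0 l1] x0 eta12 /andP[u0 ue] /andP[v10 v1e] /andP[v20 v2e] xe d1 d2 H.
have eta0 : 0 <= eta by exact: le_trans v1e.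
have m0 : 0 <= 1 - lam by rewrite subr_ge0.
pose P := lam * (1 - lam) * x ^+ 2.
have lm0 : 0 <= lam * (1 - lam) by rewrite mulr_ge0.
have P0 : 0 <= P by rewrite mulr_ge0 ?sqr_ge0.
rewrite -/P; set D := _ - u ^+ 2.
have [D0|D0] := leP D 0.
  by rewrite (le_trans D0)// mulr_ge0// addr_ge0// mulr_ge0// sqr_ge0.
pose S := sin u / (2 * u).
pose h := sin (x / 2); pose C := cos (x / 2).
have pi2 := pi_ge2 R.
have x20 : 0 < x / 2 by rewrite divr_gt0.
have h0 : 0 < h by apply: sin_gt0_pi; lra.
have hx : h <= x / 2 by exact: sin_le_id (ltW x20).
have Cl : 1 - eta ^+ 2 / 2 <= C.
  apply: le_trans (cos_ge_quad (ltW x20)).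
  by rewrite lerD2l lerN2 ler_pM2r ?invr_gt0// ler_sqr ?nnegrE ?(ltW x20)//; lra.
have e14 : eta ^+ 2 <= 4^-1.
  have -> : 4^-1 = (2^-1) ^+ 2 :> R by field.
  by rewrite ler_sqr ?nnegrE.
have e20 := sqr_ge0 eta.
have C0 : 0 < C by lra.
have C1 : C <= 1 := cos_le1 _.
have Sl : (1 - eta ^+ 2 / 6) / 2 <= S.
  rewrite /S ler_pdivlMr ?mulr_gt0//.
  apply: le_trans (sin_ge_cubic (ltW u0)).
  have : u * u ^+ 2 <= u * eta ^+ 2 by rewrite ler_pM2l// ler_sqr ?nnegrE ?(ltW u0).
  have -> : u ^+ 3 = u * u ^+ 2 by rewrite exprS.
  lra.
have X2 : sin x = 2 * h * C by rewrite [in LHS](splitr x) sinD /h /C; ring.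
pose p := lam * (x / 2); pose q := (1 - lam) * (x / 2).
have p0 : 0 <= p by rewrite mulr_ge0// ltW.
have q0 : 0 <= q by rewrite mulr_ge0// ltW.
have defect : sin ((1 - lam) * x) + sin (lam * x) - sin x = 4 * h * (sin p * sin q).
  have -> : sin x = sin ((p + q) + (p + q)) by congr sin; rewrite /p /q; field.
  have -> : sin ((1 - lam) * x) = sin (q + q) by congr sin; rewrite /q; field.
  have -> : sin (lam * x) = sin (p + p) by congr sin; rewrite /p; field.
  have -> : h = sin (p + q) by congr sin; rewrite /p /q; field.
  rewrite !(sinD, cosD).
  have ep := cos2Dsin2 p; have eq := cos2Dsin2 q.
  move: (cos p) (sin p) (cos q) (sin q) ep eq => cp sp cq sq ep eq.
  have -> : sq * cq + cq * sq = (sq * cq + cq * sq) * (cp ^+ 2 + sp ^+ 2).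
    by rewrite ep mulr1.
  have -> : sp * cp + cp * sp = (sp * cp + cp * sp) * (cq ^+ 2 + sq ^+ 2).
    by rewrite eq mulr1.
  ring.
have spq : 4 * (sin p * sin q) <= P.
  have -> : P = 4 * (p * q) by rewrite /P /p /q; field.
  rewrite ler_pM2l// (le_trans (ler_norm _))// normrM ler_pM//.
    exact: normr_sin_le.
  exact: normr_sin_le.
have quart (v : R) : 0 <= v <= eta -> (v ^+ 2 - u ^+ 2) ^+ 2 <= 4 * eta ^+ 2 * `|v - u| ^+ 2.
  move=> /andP[v0 ve]; rewrite real_normK ?num_real//.
  have -> : (v ^+ 2 - u ^+ 2) ^+ 2 = (v + u) ^+ 2 * (v - u) ^+ 2 by ring.
  have -> : 4 * eta ^+ 2 = (2 * eta) ^+ 2 by ring.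
  by rewrite ler_wpM2r ?sqr_ge0// ler_sqr ?nnegrE; clear -v0 ve u0 ue eta0; lra.
have q1 : `|v1 - u| ^+ 2 <= (lam * x) ^+ 2.
  by rewrite ler_sqr ?nnegrE// mulr_ge0// ltW.
have q2 : `|v2 - u| ^+ 2 <= ((1 - lam) * x) ^+ 2.
  by rewrite ler_sqr ?nnegrE// mulr_ge0// ltW.
have qP : (1 - lam) * `|v1 - u| ^+ 2 + lam * `|v2 - u| ^+ 2 <= P.
  have := lerD (ler_wpM2l m0 q1) (ler_wpM2l l0 q2).
  by rewrite /P; lra.
have T1 := cos_le_tangent u0 v10; have T2 := cos_le_tangent u0 v20.
rewrite -/S in T1 T2.
have avg : (1 - lam) * cos v1 + lam * cos v2 <= cos u - S * D + eta ^+ 2 * P / 6.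
  have w1 := quart v1; have w2 := quart v2.
  have {}w1 := w1 (introT andP (conj v10 v1e)).
  have {}w2 := w2 (introT andP (conj v20 v2e)).
  have t1 := ler_wpM2l m0 T1; have t2 := ler_wpM2l l0 T2.
  have y1 := ler_wpM2l m0 w1; have y2 := ler_wpM2l l0 w2.
  have z := ler_wpM2l (mulr_ge0 (ler0n R 4) e20) qP.
  by rewrite /D; clear -t1 t2 y1 y2 z; lra.
have x2 : x <= 1 by lra.
have xpi : 0 <= x <= pi by lra.
have X0 : 0 <= sin x by apply: sin_ge0_pi.
have g1 : (sin ((1 - lam) * x) - (1 - lam) * sin x) * cos v1 <=
          (sin ((1 - lam) * x) - (1 - lam) * sin x).
  rewrite ler_piMr ?cos_le1// subr_ge0 sin_star//; lra.
have g2 : (sin (lam * x) - lam * sin x) * cos v2 <= (sin (lam * x) - lam * sin x).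
  rewrite ler_piMr ?cos_le1// subr_ge0 sin_star//; lra.
have key : sin x * (S * D) <= h * P + sin x * (eta ^+ 2 * P / 6).
  have := ler_wpM2l X0 avg.
  have := ler_wpM2l (ltW h0) spq.
  by clear -g1 g2 H defect; lra.
have key2 : h * (2 * C * (S * D)) <= h * (P * (1 + eta ^+ 2 / 3)).
  rewrite X2 in key.
  have : h * (P * eta ^+ 2) * C <= h * (P * eta ^+ 2).
    by rewrite ler_piMr// mulr_ge0 ?(ltW h0)// mulr_ge0.
  by clear -key; lra.
rewrite ler_pM2l// in key2.
have key3 : (1 - 2 * eta ^+ 2 / 3) * D <= P * (1 + eta ^+ 2 / 3).
  apply: le_trans key2; rewrite mulrA ler_pM2r//.
  have : (1 - eta ^+ 2 / 2) * ((1 - eta ^+ 2 / 6) / 2) <= C * S.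
    rewrite ler_pM//; clear -Cl Sl e14 e20; lra.
  have : 0 <= eta ^+ 2 * eta ^+ 2 by rewrite mulr_ge0.
  lra.
have e3 : 1 + eta ^+ 2 / 3 <= (1 - 2 * eta ^+ 2 / 3) * (1 + 3 * eta ^+ 2).
  have : eta ^+ 2 * eta ^+ 2 <= eta ^+ 2 * 4^-1 by rewrite ler_wpM2l.
  lra.
have k0 : 0 < 1 - 2 * eta ^+ 2 / 3 by clear -e14; lra.
rewrite -(ler_pM2l k0) (le_trans key3)//.
have := ler_wpM2l P0 e3; clear; lra.
Qed.

End almost_euclidean.

Section hinges.
Context {R : realType}.
Implicit Types (A B L tau : R).

Lemma acos_angle (c : R) : -1 <= c <= 1 -> 0 <= acos c <= pi.
Proof. by move=> h; rewrite acos_ge0//= acos_lepi. Qed.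

Lemma cosh_surj (y b : R) : 0 <= b -> 1 <= y <= cosh b ->
  exists2 c : R, 0 <= c & cosh c = y.
Proof.
move=> b0 /andP[y1 yb].
have fc : {within `[0, b], continuous (@cosh R)}.
  apply: continuous_subspaceT => x.
  apply/differentiable_continuous/derivable1_diffP.
  exact: (@ex_derive _ _ _ _ _ _ _ (is_derive_cosh x)).
have := @IVT R (@cosh R) 0 b y b0 fc.
rewrite cosh0 minEle maxEle (le_trans y1 yb) y1 yb => /(_ isT)[c].
by rewrite in_itv/= => /andP[c0 _] <-; exists c.
Qed.

(** The last identity no longer contains the angle: [cosh] of the distance to a
    point moving along a side solves a linear second order equation and is
    determined by its values at both ends. *)
Lemma hyperbolic_hinge A B L tau : 0 < A -> 0 < L -> 0 <= B ->
  A <= B + L -> L <= A + B -> B <= A + L -> 0 <= tau <= L ->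
  exists theta ell, [/\ 0 <= theta <= pi, 0 <= ell,
    cosh B = cosh A * cosh L - sinh A * sinh L * cos theta,
    cosh ell = cosh A * cosh tau - sinh A * sinh tau * cos theta &
    sinh L * cosh ell = sinh (L - tau) * cosh A + sinh tau * cosh B].
Proof.
move=> A0 L0 B0 tA tL tB /andP[t0 tauL].
have sA := sinh_gt0 A0; have sL := sinh_gt0 L0.
pose c := (cosh A * cosh L - cosh B) / (sinh A * sinh L).
have sAL : 0 < sinh A * sinh L by rewrite mulr_gt0.
have c1 : c <= 1.
  rewrite /c ler_pdivrMr// mul1r lerBlDl -lerBlDr.
  have -> : cosh A * cosh L - sinh A * sinh L = cosh (A - L).
    by rewrite coshD coshN sinhN mulrN.
  have [LA|/ltW AL] := leP L A; first by apply: cosh_ndecr; lra.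
  by rewrite -coshN; apply: cosh_ndecr; lra.
have cN1 : -1 <= c.
  rewrite /c ler_pdivlMr// mulN1r lerBrDl addrC -lerBrDl opprK -coshD.
  by apply: cosh_ndecr.
have cI : -1 <= c <= 1 by rewrite cN1.
have cE : cos (acos c) = c by rewrite acosK// in_itv/= cI.
have scE : sinh A * sinh L * c = cosh A * cosh L - cosh B.
  by rewrite /c mulrC divfK// gt_eqF.
have st0 : 0 <= sinh tau := sinh_ge0 t0.
have sAt : 0 <= sinh A * sinh tau by exact: mulr_ge0 (ltW sA) st0.
have [||ell ell0 ellE] := @cosh_surj (cosh A * cosh tau - sinh A * sinh tau * c) (A + tau).
- by rewrite addr_ge0// ltW.
- apply/andP; split; last first.
    by rewrite coshD lerD2l -mulrN ler_piMr// lerNl.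
  apply: (le_trans (cosh_ge1 (A - tau))).
  rewrite coshD coshN sinhN mulrN lerD2l lerN2 ler_piMr//.
exists (acos c), ell; rewrite cE; split => //.
- exact: acos_angle.
- by rewrite scE; ring.
- rewrite ellE sinhD coshN sinhN.
  have -> : cosh B = cosh A * cosh L - sinh A * sinh L * c by rewrite scE; ring.
  ring.
Qed.

Lemma spherical_hinge A B L tau : 0 < A -> 0 < L -> 0 <= B ->
  A <= B + L -> L <= A + B -> B <= A + L -> A + L <= 2 -> 0 <= tau <= L ->
  exists theta ell, [/\ 0 <= theta <= pi, 0 <= ell <= pi,
    cos B = cos A * cos L + sin A * sin L * cos theta,
    cos ell = cos A * cos tau + sin A * sin tau * cos theta &
    sin L * cos ell = sin (L - tau) * cos A + sin tau * cos B].
Proof.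
move=> A0 L0 B0 tA tL tB AL2 /andP[t0 tauL].
have pi2 := pi_ge2 R.
have sA : 0 < sin A by apply: sin_gt0_pi; lra.
have sL : 0 < sin L by apply: sin_gt0_pi; lra.
pose c := (cos B - cos A * cos L) / (sin A * sin L).
have sAL : 0 < sin A * sin L by rewrite mulr_gt0.
have c1 : c <= 1.
  rewrite /c ler_pdivrMr// mul1r lerBlDl -cosB.
  have [LA|/ltW AL] := leP L A; first by apply: cos_nincr; lra.
  by rewrite -(cosN (A - L)); apply: cos_nincr; lra.
have cN1 : -1 <= c.
  rewrite /c ler_pdivlMr// mulN1r lerBrDl -cosD.
  by apply: cos_nincr; lra.
have cI : -1 <= c <= 1 by rewrite cN1.
have cE : cos (acos c) = c by rewrite acosK// in_itv/= cI.
have scE : sin A * sin L * c = cos B - cos A * cos L.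
  by rewrite /c mulrC divfK// gt_eqF.
have st0 : 0 <= sin tau by apply: sin_ge0_pi; lra.
have sAt : 0 <= sin A * sin tau by rewrite mulr_ge0// ltW.
pose y := cos A * cos tau + sin A * sin tau * c.
have yI : -1 <= y <= 1.
  apply/andP; split.
    apply: (le_trans (cos_geN1 (A + tau))); rewrite cosD lerD2l -mulrN1.
    by rewrite ler_wpM2l.
  apply: (le_trans _ (cos_le1 (A - tau))); rewrite cosB lerD2l.
  by rewrite ler_piMr.
have yE : cos (acos y) = y by rewrite acosK// in_itv/= yI.
exists (acos c), (acos y); rewrite cE yE; split => //.
- exact: acos_angle.
- exact: acos_angle.
- by rewrite scE; ring.
- rewrite sinB.
  have -> : cos B = cos A * cos L + sin A * sin L * c by rewrite scE; ring.
  rewrite /y; ring.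
Qed.

Lemma euclidean_hinge A B L tau : 0 < A -> 0 < L -> 0 <= B ->
  A <= B + L -> L <= A + B -> B <= A + L -> 0 <= tau <= L ->
  exists theta ell, [/\ 0 <= theta <= pi, 0 <= ell,
    B ^+ 2 = A ^+ 2 + L ^+ 2 - 2 * A * L * cos theta,
    ell ^+ 2 = A ^+ 2 + tau ^+ 2 - 2 * A * tau * cos theta &
    L * ell ^+ 2 = (L - tau) * A ^+ 2 + tau * B ^+ 2 - L * tau * (L - tau)].
Proof.
move=> A0 L0 B0 tA tL tB /andP[t0 tauL].
pose c := (A ^+ 2 + L ^+ 2 - B ^+ 2) / (2 * A * L).
have sAL : 0 < 2 * A * L by rewrite !mulr_gt0.
have c1 : c <= 1.
  rewrite /c ler_pdivrMr// mul1r -subr_ge0.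
  have -> : 2 * A * L - (A ^+ 2 + L ^+ 2 - B ^+ 2) = (B - A + L) * (B + A - L) by ring.
  by rewrite mulr_ge0//; lra.
have cN1 : -1 <= c.
  rewrite /c ler_pdivlMr// mulN1r -subr_ge0.
  have -> : A ^+ 2 + L ^+ 2 - B ^+ 2 - - (2 * A * L) = (A + L - B) * (A + L + B) by ring.
  by rewrite mulr_ge0//; lra.
have cI : -1 <= c <= 1 by rewrite cN1.
have cE : cos (acos c) = c by rewrite acosK// in_itv/= cI.
have scE : 2 * A * L * c = A ^+ 2 + L ^+ 2 - B ^+ 2.
  by rewrite /c mulrC divfK// gt_eqF.
pose y := A ^+ 2 + tau ^+ 2 - 2 * A * tau * c.
have y0 : 0 <= y.
  have -> : y = (A - tau) ^+ 2 + 2 * A * tau * (1 - c) by rewrite /y; ring.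
  by rewrite addr_ge0 ?sqr_ge0// mulr_ge0 ?subr_ge0// !mulr_ge0// ltW.
exists (acos c), (Num.sqrt y); rewrite cE sqr_sqrtr//; split => //.
- exact: acos_angle.
- by rewrite scE; ring.
- have -> : B ^+ 2 = A ^+ 2 + L ^+ 2 - 2 * A * L * c by rewrite scE; ring.
  rewrite /y; ring.
Qed.

End hinges.

Section almost_euclidean_comparison.
Context {R : realType} (M : metricType R).

(** The summands are the constants of the spherical and of the hyperbolic
    case. *)
Definition curvature_factor (k : R) : R := (3 + sinh 1 ^+ 2) * `|k|.

Lemma curvature_factor_ge0 k : 0 <= curvature_factor k.
Proof. by rewrite mulr_ge0// addr_ge0// sqr_ge0. Qed.

(** The comparison distance is replaced by the actual one, which only weakens
    the inequality and for which the triangle inequality is available in the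
    space itself. *)
Lemma triangle_comparison_almost_euclidean (k eta : R) (U : set M)
    (a b c : M) (g : R -> M) (lam : R) :
  triangle_comparison k U -> U a -> U b -> U c ->
  `|k| * eta ^+ 2 <= 4^-1 ->
  shortest_curve (mdist a c) g -> g 0 = a -> g (mdist a c) = c ->
  0 <= lam <= 1 ->
  mdist a b <= eta -> mdist c b <= eta -> mdist b (g (lam * mdist a c)) <= eta ->
  (1 - lam) * mdist a b ^+ 2 + lam * mdist c b ^+ 2
    - mdist b (g (lam * mdist a c)) ^+ 2 <=
  (1 + curvature_factor k * eta ^+ 2) * (lam * (1 - lam) * mdist a c ^+ 2).
Proof.
move=> cmp Ua Ub Uc keta [_ gE] g0 gL l01 abe cbe bge.
have /andP[l0 l1] := l01.
have m0 : 0 <= 1 - lam by rewrite subr_ge0.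
set L := mdist a c in gE gL bge *.
have L0 : 0 <= L by exact: mdist_ge0.
set tau := lam * L in bge *.
have tau0 : 0 <= tau by rewrite mulr_ge0.
have tauL : tau <= L by rewrite ler_piMl.
have tauI : tau \in `[0, L] by rewrite in_itv/= tau0.
have I0 : (0 : R) \in `[0, L] by rewrite in_itv/= lexx.
have IL : L \in `[0, L] by rewrite in_itv/= L0 lexx.
have dag : mdist a (g tau) = tau by rewrite -{1}g0 gE// sub0r normrN ger0_norm.
have dcg : mdist c (g tau) = L - tau by rewrite -{1}gL gE// ger0_norm ?subr_ge0.
set A := mdist a b in abe *; set B := mdist c b in cbe *.
set d := mdist b (g tau) in bge *.
have A0 : 0 <= A by exact: mdist_ge0.
have B0 : 0 <= B by exact: mdist_ge0.
have d0 : 0 <= d by exact: mdist_ge0.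
have tri1 : A <= tau + d.
  by rewrite -dag /d (metric_sym b); exact: metric_triangle.
have tri2 : d <= A + tau.
  by rewrite -dag /d /A (metric_sym a b); exact: metric_triangle.
have tri3 : B <= (L - tau) + d.
  by rewrite -dcg /d (metric_sym b); exact: metric_triangle.
have tri4 : d <= B + (L - tau).
  by rewrite -dcg /d /B (metric_sym c b); exact: metric_triangle.
have triL : L <= A + B by rewrite /B (metric_sym c b); exact: metric_triangle.
have triA : A <= B + L by rewrite addrC; exact: metric_triangle.
have triB : B <= A + L by rewrite addrC /L (metric_sym a c); exact: metric_triangle.
have K0 := curvature_factor_ge0 k.
pose P := lam * (1 - lam) * L ^+ 2.
have P0 : 0 <= P by rewrite !mulr_ge0// sqr_ge0.
have e20 : 0 <= eta ^+ 2 by exact: sqr_ge0.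
have Ke0 : 0 <= curvature_factor k * eta ^+ 2 by rewrite mulr_ge0.
rewrite -/P.
(* Degenerate triangles have no angle to compare, but in them the triangle
   inequalities between the distances collapse to equalities. *)
have weak : (1 - lam) * A ^+ 2 + lam * B ^+ 2 - d ^+ 2 <= P ->
    (1 - lam) * A ^+ 2 + lam * B ^+ 2 - d ^+ 2 <= (1 + curvature_factor k * eta ^+ 2) * P.
  by move/le_trans; apply; rewrite mulrDl mul1r lerDl mulr_ge0.
have [dz|dn0] := eqVneq d 0.
  apply: weak.
  have -> : A = tau by clear -tri1 tri3 triL dz; apply/le_anti/andP; split; lra.
  have -> : B = L - tau by clear -tri1 tri3 triL dz; apply/le_anti/andP; split; lra.
  by rewrite dz /P /tau le_eqVlt; apply/orP; left; apply/eqP; ring.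
have [Lz|Ln0] := eqVneq L 0.
  have tz : tau = 0 by rewrite /tau Lz mulr0.
  apply: weak.
  have -> : A = d by clear -tri1 tri2 tz; apply/le_anti/andP; split; lra.
  have -> : B = d by clear -tri3 tri4 tz Lz; apply/le_anti/andP; split; lra.
  by rewrite /P Lz le_eqVlt; apply/orP; left; apply/eqP; ring.
have [Az|An0] := eqVneq A 0.
  apply: weak.
  have -> : B = L by clear -triL triB Az; apply/le_anti/andP; split; lra.
  have -> : d = tau by clear -tri1 tri2 tri3 triL Az; apply/le_anti/andP; split; lra.
  by rewrite Az /P /tau le_eqVlt; apply/orP; left; apply/eqP; ring.
have {dn0}dp : 0 < d by rewrite lt_neqAle eq_sym dn0.
have {Ln0}Lp : 0 < L by rewrite lt_neqAle eq_sym Ln0.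
have {An0}Ap : 0 < A by rewrite lt_neqAle eq_sym An0.
have eta0 : 0 < eta by exact: lt_le_trans bge.
have sym_bc : mdist b c = B by rewrite metric_sym.
have cmp' theta ell : model_hinge k A L theta B -> model_hinge k A tau theta ell -> ell <= d.
  move=> h1 h2; apply: (cmp a b c g tau theta ell) => //.
  by rewrite sym_bc.
pose w := Num.sqrt `|k|.
have w2 : w ^+ 2 = `|k| by rewrite sqr_sqrtr.
have w0 : 0 <= w by exact: sqrtr_ge0.
have weta : w * eta <= 2^-1.
  have we0 : 0 <= w * eta by rewrite mulr_ge0// ltW.
  rewrite -ler_sqr ?nnegrE// exprMn w2 (le_trans keta)// le_eqVlt; apply/orP; left.
  by apply/eqP; field.
have scale2 (x y z : R) : x <= y + z -> w * x <= w * y + w * z.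
  by rewrite -mulrDr; exact: ler_wpM2l.
have scaleI : 0 < w -> 0 <= w * tau <= w * L.
  by move=> wp; rewrite mulr_ge0//= ler_pM2l.
have vA : 0 <= w * A <= w * eta by rewrite mulr_ge0//= ler_wpM2l.
have vB : 0 <= w * B <= w * eta by rewrite mulr_ge0//= ler_wpM2l.
have L2 : L <= 2 * eta by clear -triL abe cbe; lra.
have xle : w * L <= 2 * (w * eta) by rewrite mulrCA ler_wpM2l.
have scaled : (1 - lam) * (w * A) ^+ 2 + lam * (w * B) ^+ 2 - (w * d) ^+ 2 =
    w ^+ 2 * ((1 - lam) * A ^+ 2 + lam * B ^+ 2 - d ^+ 2) by ring.
have descale (x y : R) : 0 < w -> w ^+ 2 * x <= w ^+ 2 * y -> x <= y.
  by move=> wp; rewrite ler_pM2l// exprn_gt0.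
have [k0|k0|k0] := ltgtP k 0; last first.
- have [theta [ell [th ell0 e1 e2 e3]]] := euclidean_hinge Ap Lp B0 triA triL triB (introT andP (conj tau0 tauL)).
  have elld : ell <= d.
    apply: (cmp' theta).
      by split => //; rewrite /law_of_cosines k0 ?eqxx// ltxx.
    by split => //; rewrite /law_of_cosines k0 ?eqxx// ltxx.
  apply: weak.
  have : ell ^+ 2 <= d ^+ 2 by rewrite ler_sqr ?nnegrE.
  rewrite -(ler_pM2l Lp) e3 /tau => ed.
  by rewrite -(ler_pM2l Lp) /P; clear -ed; lra.
- have wp : 0 < w by rewrite sqrtr_gt0 normr_gt0 (gt_eqF k0).
  have pi2 := pi_ge2 R.
  have wE : Num.sqrt k = w by rewrite /w gtr0_norm.
  have small y : y <= 2 * eta -> w * y <= 1.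
    by move=> /(ler_wpM2l (ltW wp)) wy; clear -wy weta; lra.
  have eta2 : eta <= 2 * eta by rewrite ler_peMl ?ler1n// ltW.
  have wA1 : w * A <= 1 by rewrite small// (le_trans abe).
  have wB1 : w * B <= 1 by rewrite small// (le_trans cbe).
  have wd1 : w * d <= 1 by rewrite small// (le_trans bge).
  have wL1 : w * L <= 1 by exact: small.
  have AL2 : w * A + w * L <= 2 by clear -wA1 wL1; lra.
  have [theta [ell [th /andP[ell0 ellpi] e1 e2 e3]]] :=
    spherical_hinge (mulr_gt0 wp Ap) (mulr_gt0 wp Lp) (mulr_ge0 (ltW wp) B0)
      (scale2 _ _ _ triA) (scale2 _ _ _ triL) (scale2 _ _ _ triB) AL2 (scaleI wp).
  have wdpi : w * d <= pi by clear -wd1 pi2; lra.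
  have elld : ell / w <= d.
    apply: (cmp' theta); split => //; rewrite ?divr_ge0 ?(ltW wp)//.
    + by move=> _; rewrite wE; clear -wB1 pi2; lra.
    + by rewrite /law_of_cosines gt_eqF// k0.
    + by move=> _; rewrite wE mulrC divfK// gt_eqF.
    + by rewrite /law_of_cosines gt_eqF// k0 -/w mulrC divfK ?gt_eqF.
  have Hu : sin (w * L) * cos (w * d) <=
      sin ((1 - lam) * (w * L)) * cos (w * A) + sin (lam * (w * L)) * cos (w * B).
    have -> : (1 - lam) * (w * L) = w * L - w * tau by rewrite /tau; ring.
    have -> : lam * (w * L) = w * tau by rewrite /tau; ring.
    rewrite -e3 ler_pM2l ?cos_nincr//.
      by rewrite -ler_pdivrMl// mulrC.
    by apply: sin_gt0_pi; rewrite mulr_gt0//=; clear -wL1 pi2; lra.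
  have ud : 0 < w * d <= w * eta by rewrite mulr_gt0//= ler_pM2l.
  have dA : `|w * A - w * d| <= lam * (w * L).
    rewrite -mulrBr normrM (gtr0_norm wp) mulrCA ler_pM2l// -/tau ler_norml.
    by clear -tri1 tri2; apply/andP; split; lra.
  have dB : `|w * B - w * d| <= (1 - lam) * (w * L).
    rewrite -mulrBr normrM (gtr0_norm wp) mulrCA ler_pM2l// mulrBl mul1r -/tau ler_norml.
    by clear -tri3 tri4; apply/andP; split; lra.
  have := spherical_almost_euclidean l01 (mulr_gt0 wp Lp) weta ud vA vB xle dA dB Hu.
  rewrite scaled => /le_trans H; apply: (descale _ _ wp); apply: H.
  rewrite -/P; have -> : lam * (1 - lam) * (w * L) ^+ 2 = w ^+ 2 * P by rewrite /P; ring.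
  rewrite [leRHS]mulrCA ler_wpM2r//; first by rewrite mulr_ge0// sqr_ge0.
  by rewrite lerD2l exprMn w2 mulrA ler_wpM2r// ler_wpM2r// lerDl sqr_ge0.
- have wp : 0 < w by rewrite sqrtr_gt0 normr_gt0 (lt_eqF k0).
  have [theta [ell [th ell0 e1 e2 e3]]] :=
    hyperbolic_hinge (mulr_gt0 wp Ap) (mulr_gt0 wp Lp) (mulr_ge0 (ltW wp) B0)
      (scale2 _ _ _ triA) (scale2 _ _ _ triL) (scale2 _ _ _ triB) (scaleI wp).
  have elld : ell / w <= d.
    apply: (cmp' theta); split => //; rewrite ?divr_ge0 ?(ltW wp)//.
    + by move=> kp; move: (lt_trans kp k0); rewrite ltxx.
    + by rewrite /law_of_cosines lt_eqF// ltNge (ltW k0).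
    + by move=> kp; move: (lt_trans kp k0); rewrite ltxx.
    + by rewrite /law_of_cosines lt_eqF// ltNge (ltW k0)/= -/w mulrC divfK ?gt_eqF.
  have Hu : sinh ((1 - lam) * (w * L)) * cosh (w * A) + sinh (lam * (w * L)) * cosh (w * B)
      <= sinh (w * L) * cosh (w * d).
    have -> : (1 - lam) * (w * L) = w * L - w * tau by rewrite /tau; ring.
    have -> : lam * (w * L) = w * tau by rewrite /tau; ring.
    rewrite -e3 ler_pM2l ?sinh_gt0 ?mulr_gt0// cosh_ndecr//.
    by rewrite -ler_pdivrMl// mulrC.
  have := hyperbolic_almost_euclidean l01 (mulr_gt0 wp Lp) xle (mulr_gt0 wp dp) vA vB Hu.
  rewrite scaled => /le_trans H; apply: (descale _ _ wp); apply: H.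
  rewrite -/P; have -> : lam * (1 - lam) * (w * L) ^+ 2 = w ^+ 2 * P by rewrite /P; ring.
  rewrite [leRHS]mulrCA ler_wpM2r//; first by rewrite mulr_ge0// sqr_ge0.
  have c2 : cosh (w * eta) ^+ 2 = 1 + sinh (w * eta) ^+ 2.
    by rewrite -(cosh2sinh2 (w * eta)); ring.
  rewrite c2 lerD2l.
  have we0 : 0 <= w * eta by rewrite mulr_ge0// ltW.
  have : sinh (w * eta) <= w * eta * sinh 1.
    rewrite -{1}(mulr1 (w * eta)); apply: sinh_star => //.
    by rewrite we0/=; clear -weta; lra.
  move=> sl; have s0 : 0 <= sinh (w * eta) by exact: sinh_ge0.
  have : sinh (w * eta) ^+ 2 <= (w * eta * sinh 1) ^+ 2.
    by rewrite ler_sqr ?nnegrE// (le_trans s0).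
  move=> /le_trans; apply.
  have -> : (w * eta * sinh 1) ^+ 2 = sinh 1 ^+ 2 * `|k| * eta ^+ 2 by rewrite -w2; ring.
  by rewrite ler_wpM2r// ler_wpM2r// lerDr.
Qed.

End almost_euclidean_comparison.

(** * Existence of shortest curves *)

Section distance.
Context {R : realType} {M : metricType R}.
Implicit Types (x y z : M).

Lemma mdist_lip x y z : `|mdist x y - mdist x z| <= mdist y z.
Proof.
have t1 := metric_triangle x y z; have t2 := metric_triangle x z y.
rewrite (metric_sym z y) in t2.
by rewrite ler_norml; apply/andP; split; lra.
Qed.

Lemma mdist_continuous x : continuous (mdist x : M -> R).
Proof.
move=> y; apply/cvgrPdist_lt => e e0; apply/nbhs_ballP; exists e => //= z.
by rewrite ballEmdist/= => yz; rewrite (le_lt_trans (mdist_lip _ _ _)).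
Qed.

End distance.

Section near_shortest.
Context {R : realType} {M : metricType R}.

Lemma curve_length_ge1 (g : R -> M) t : 0 <= t <= 1 ->
  ((mdist (g 0%R) (g t) + mdist (g t) (g 1%R))%:E <= curve_length 0 1 g)%E.
Proof.
move=> /andP[t0 t1]; rewrite /curve_length.
have [->|tn0] := eqVneq t 0.
  rewrite mdistxx add0r; apply: ereal_sup_ubound; exists [:: 1] => /=.
    by apply: itv_partition1.
  by rewrite big_nat1.
have [->|tn1] := eqVneq t 1.
  rewrite mdistxx addr0; apply: ereal_sup_ubound; exists [:: 1] => /=.
    by apply: itv_partition1.
  by rewrite big_nat1.
apply: ereal_sup_ubound; exists [:: t; 1] => /=.
  by rewrite /itv_partition/= eqxx !lt_neqAle t0 t1 tn1 eq_sym tn0.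
by rewrite /index_iota/= !big_cons big_nil/= addr0.
Qed.

Lemma curve_length_ge2 (g : R -> M) t u : 0 <= t -> t <= u -> u <= 1 ->
  ((mdist (g 0%R) (g t) + mdist (g t) (g u) + mdist (g u) (g 1%R))%:E
    <= curve_length 0 1 g)%E.
Proof.
move=> t0 tu u1; have t1 := le_trans tu u1; have u0 := le_trans t0 tu.
have [tz|tn0] := eqVneq t 0.
  by rewrite tz mdistxx add0r curve_length_ge1// u0.
have [tE|tnu] := eqVneq t u.
  by rewrite tE mdistxx addr0 curve_length_ge1// u0.
have [->|un1] := eqVneq u 1.
  by rewrite mdistxx addr0 curve_length_ge1// t0.
apply: ereal_sup_ubound; exists [:: t; u; 1] => /=.
  by rewrite /itv_partition/= eqxx !lt_neqAle t0 tu u1 un1 tnu eq_sym tn0.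
by rewrite /index_iota/= !big_cons big_nil/= addr0 addrA.
Qed.

(** A curve whose length exceeds [d(x, y)] by at most [e] becomes, after
    selecting for each [s] a point at distance [s] from [x], an isometric
    embedding up to [e]; the selection need not be monotone, because a wrongly
    ordered pair of points is [e]-close. *)
Lemma near_shortest_curve (x y : M) (e : R) : length_space M -> 0 < e ->
  exists h : R -> M,
    [/\ forall s, s \in `[0, mdist x y] -> mdist x (h s) = s,
        forall s, s \in `[0, mdist x y] -> mdist (h s) y <= mdist x y - s + e &
        forall s t, s \in `[0, mdist x y] -> t \in `[0, mdist x y] ->
          `|mdist (h s) (h t) - `|s - t| | <= e].
Proof.
move=> lenM e0; set L := mdist x y.
have : (ereal_inf [set curve_length 0 1 g | g in
    [set g : R -> M | [/\ {within `[0%R, 1%R], continuous g}, g 0%R = x & g 1%R = y]]]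
    < (L + e)%:E)%E.
  by rewrite -lenM lte_fin ltrDl.
move=> /ereal_inf_lt[_ /= [g [gc g0 g1] <-] gL].
have dc : {within `[0, 1], continuous (fun t => mdist x (g t))}.
  by move=> t; apply: continuous_comp; [exact: gc|exact: mdist_continuous].
have ivt s : s \in `[0, L] -> exists t, (t \in `[0, 1]) && (mdist x (g t) == s).
  rewrite in_itv/= => sL.
  have := @IVT R (fun t => mdist x (g t)) 0 1 s ler01 dc.
  rewrite g0 g1 mdistxx -/L minEle maxEle mdist_ge0 => /(_ sL)[t tI tE].
  by exists t; rewrite tI tE eqxx.
pose h s := g (xget 0 [set t | (t \in `[0, 1]) && (mdist x (g t) == s)]).
have hP s : s \in `[0, L] -> exists t, [/\ 0 <= t, t <= 1, h s = g t & mdist x (g t) = s].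
  move=> /ivt[t tP]; rewrite /h; case: xgetP => [u _ /= /andP[]|]; last first.
    by move=> /(_ t)/=; rewrite tP.
  by rewrite in_itv/= => /andP[u0 u1] /eqP us; exists u.
have len t u : 0 <= t -> t <= u -> u <= 1 ->
    mdist x (g t) + mdist (g t) (g u) + mdist (g u) y < L + e.
  move=> t0 tu u1; rewrite -lte_fin (le_lt_trans _ gL)// -g0 -g1.
  exact: curve_length_ge2.
exists h; split.
- by move=> s /hP[t [_ _ -> ->]].
- move=> s /hP[t [t0 t1 -> ts]]; have := len t t t0 (lexx _) t1.
  by rewrite ts mdistxx; lra.
move=> s t /hP[u [u0 u1 -> us]] /hP[v [v0 v1 -> vt]].
wlog uv : s t u v u0 u1 us v0 v1 vt / u <= v.
  move=> H; have [uv|/ltW vu] := leP u v; first exact: H.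
  by rewrite metric_sym (distrC s); exact: H.
have := len u v u0 uv v1; rewrite us => l1.
have t1 := metric_triangle x (g v) y; rewrite vt -/L in t1.
have := mdist_lip x (g u) (g v); rewrite us vt ler_norml => /andP[a b].
have := mdist_ge0 (g u) (g v) => d0.
rewrite ler_norml; have [st|ts] := leP s t.
  by rewrite ler0_norm ?subr_le0//; apply/andP; split; lra.
by rewrite gtr0_norm ?subr_gt0//; apply/andP; split; lra.
Qed.

End near_shortest.

Section proper.
Context {R : realType} {M : completeMetricType R}.

Lemma finite_net (p : M) (r e : R) : finite_dimensional M -> 0 < e ->
  exists s : seq M, forall y, ball p r y -> exists2 z, z \in s & mdist z y < e.
Proof.
move=> [n dimM] e0; have [C HC] := dimM p r.
apply: contrapT => noNet.
pose e' := Num.min e 1.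
have e'0 : 0 < e' by rewrite lt_min e0 ltr01.
have e'1 : 0 < e' <= 1 by rewrite e'0/= ge_min lexx orbT.
have grow k : exists2 s : seq M, size s = k & Defs.separated e' (ball p r) s.
  elim: k => [|k [s sk [us sA sep]]]; first by exists [::].
  have /existsNP[y /not_implyP[py ny]] : ~ forall y, ball p r y -> exists2 z, z \in s & mdist z y < e.
    by move=> H; apply: noNet; exists s.
  have far z : z \in s -> e' <= mdist z y.
    move=> zs; rewrite leNgt; apply/negP => zy; apply: ny; exists z => //.
    by rewrite (lt_le_trans zy)// ge_min lexx.
  exists (y :: s); first by rewrite /= sk.
  split => /=.
  - rewrite us andbT; apply/negP => /far; rewrite mdistxx.
    by rewrite leNgt e'0.
  - by move=> z; rewrite inE => /orP[/eqP->//|/sA].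
  - move=> a b; rewrite !inE => /orP[/eqP->|sa] /orP[/eqP->|sb]; rewrite ?eqxx//.
    + by move=> _; rewrite metric_sym far.
    + by move=> _; rewrite far.
    + exact: sep.
have [s sk sep] := grow (Num.bound `|C / e' ^+ n|).
have := HC e' s e'1 sep; rewrite sk -ler_pdivlMr ?exprn_gt0// leNgt.
by rewrite (le_lt_trans (ler_norm _))// archi_boundP.
Qed.

Lemma ultra_cover (T : Type) (U : set_system T) (FU : UltraFilter U) (X : eqType)
    (s : seq X) (A : X -> set T) :
  U [set t | exists2 z, z \in s & A z t] -> exists2 z, z \in s & U (A z).
Proof.
elim: s => [|a s IH] Us.
  by have [t [z]] := filter_ex Us.
have [Ua|Una] := in_ultra_setVsetC (A a) FU.
  by exists a; rewrite ?mem_head.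
have [|z zs Uz] := IH; last by exists z; rewrite // inE zs orbT.
apply: filterS2 Us Una => t [z]; rewrite inE => /orP[/eqP->|zs] Az nAt //.
by exists z.
Qed.

(** Bounded sets have finite nets, one member of which is selected by the
    ultrafilter at each scale: the ultrafilter is Cauchy. *)
Lemma bounded_ultra_cvg (T : Type) (U : set_system T) (FU : UltraFilter U)
    (u : T -> M) (p : M) (r : R) :
  finite_dimensional M -> (forall t, mdist p (u t) < r) -> cvg (u @ U).
Proof.
move=> dimM pu; apply: cauchy_cvg; apply: cauchy_exP => e e0.
have [s net] := finite_net p r dimM e0.
have cover : U [set t | exists2 z, z \in s & mdist z (u t) < e].
  by apply: filterS filterT => t _; apply: net; rewrite ballEmdist; exact: pu.
have [z _ Uz] := ultra_cover FU cover.
by exists z; rewrite ballEmdist.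
Qed.

Lemma shortest_curve_exists (x y : M) :
  length_space M -> finite_dimensional M ->
  exists g, [/\ shortest_curve (mdist x y) g, g 0 = x & g (mdist x y) = y].
Proof.
move=> lenM dimM; set L := mdist x y.
have L0 : 0 <= L := mdist_ge0 x y.
have inv0 n : 0 < n.+1%:R^-1 :> R by rewrite invr_gt0.
have hex n := cid (near_shortest_curve x y lenM (inv0 n)).
pose h n s := sval (hex n) s.
have hP n := svalP (hex n).
have [U [FU sU]] := @ultraFilterLemma nat \oo _.
have hcvg s : s \in `[0, L] -> cvg (h n s @[n --> U]).
  move=> sL; apply: (@bounded_ultra_cvg nat U FU _ x (s + 1)) => // n.
  by have [-> //] := hP n; rewrite ltrDl.
pose g s := lim (h n s @[n --> U]).
have near_g s e : s \in `[0, L] -> 0 < e -> \forall n \near U, mdist (g s) (h n s) < e.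
  move=> sL e0; have /metricType_numDomainType.cvgrPdist_lt := hcvg s sL.
  exact.
have near_inv (e : R) : 0 < e -> \forall n \near U, n.+1%:R^-1 < e.
  move=> e0; apply: sU.
  exact: (near_infty_natSinv_lt (PosNum e0)).
have gE s t : s \in `[0, L] -> t \in `[0, L] -> mdist (g s) (g t) = `|s - t|.
  move=> sL tL; apply/eqP; rewrite -subr_eq0 -normr_le0; apply/ler_addgt0Pl => e e0.
  have e3 : 0 < e / 3 by rewrite divr_gt0.
  have [n [[/= n1 n2] n3]] := filter_ex (filterI (filterI (near_g s _ sL e3) (near_g t _ tL e3)) (near_inv _ e3)).
  have [_ _ /(_ s t sL tL)] := hP n; rewrite -/(h n s) -/(h n t) -/L.
  have l1 := mdist_lip (g s) (g t) (h n t); have l2 := mdist_lip (h n t) (g s) (h n s).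
  rewrite !(metric_sym (h n t)) in l2.
  move: l1 l2; rewrite !ler_norml => /andP[a b] /andP[a' b'] /andP[c d].
  move: (n.+1%:R^-1) n3 c d => i n3 c d.
  by apply/andP; split; lra.
have I0 : (0 : R) \in `[0, L] by rewrite in_itv/= lexx.
have IL : L \in `[0, L] by rewrite in_itv/= L0 lexx.
have mdist_small (a b : M) : (forall e, 0 < e -> mdist a b <= e) -> a = b.
  move=> H; apply: mdist_positivity; apply/le_anti; rewrite mdist_ge0 andbT.
  by apply/ler_addgt0Pl => e e0; rewrite addr0; exact: H.
exists g; split => //.
- apply: mdist_small => e e0.
  have [n /= n1] := filter_ex (near_g 0 _ I0 e0).
  have [/(_ 0 I0) h0 _ _] := hP n; rewrite -/(h n 0) in h0.
  by rewrite (mdist_positivity _ _ h0) ltW.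
- apply: mdist_small => e e0.
  have e2 : 0 < e / 2 by rewrite divr_gt0.
  have [n [/= n1 n2]] := filter_ex (filterI (near_g L _ IL e2) (near_inv _ e2)).
  have [_ /(_ L IL) hL _] := hP n; rewrite -/(h n L) -/L in hL.
  have := metric_triangle (g L) (h n L) y.
  by move: (n.+1%:R^-1) n2 hL => i n2 hL; lra.
Qed.

End proper.

(** * Angles *)

Section local_comparison.
Context {R : realType} {M : metricType R}.

(** The form in which the curvature bound is used from here on: model planes
    have disappeared into the constant [K]. *)
Definition almost_euclidean_near (q : M) (K r : R) : Prop :=
  forall (a b c : M) (g : R -> M) (lam eta : R),
    eta <= r -> mdist q a < r -> mdist q b < r -> mdist q c < r ->
    shortest_curve (mdist a c) g -> g 0 = a -> g (mdist a c) = c ->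
    0 <= lam <= 1 ->
    mdist a b <= eta -> mdist c b <= eta ->
    mdist b (g (lam * mdist a c)) <= eta ->
    (1 - lam) * mdist a b ^+ 2 + lam * mdist c b ^+ 2
      - mdist b (g (lam * mdist a c)) ^+ 2 <=
    (1 + K * eta ^+ 2) * (lam * (1 - lam) * mdist a c ^+ 2).

Lemma curvature_ge_almost_euclidean (k : R) (q : M) : curvature_ge M k ->
  exists K r : R, [/\ 0 <= K, 0 < r & almost_euclidean_near q K r].
Proof.
move=> /(_ q)[r0 r0p cmp].
have k1 : 0 < 4 * (1 + `|k|) by rewrite mulr_gt0// ltr_wpDr.
pose r := Num.min r0 (4 * (1 + `|k|))^-1.
have rp : 0 < r by rewrite lt_min r0p invr_gt0.
have rr0 : r <= r0 by rewrite ge_min lexx.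
have rk : r * (4 * (1 + `|k|)) <= 1.
  by rewrite -ler_pdivlMr// mul1r ge_min lexx orbT.
exists (curvature_factor k), r; split => //; first exact: curvature_factor_ge0.
move=> a b c g lam eta er qa qb qc gs g0 gL l01 ab cb bg.
have e0 : 0 <= eta by exact: le_trans (mdist_ge0 _ _) ab.
apply: (triangle_comparison_almost_euclidean cmp) => //.
- by rewrite ballEmdist /=; exact: lt_le_trans rr0.
- by rewrite ballEmdist /=; exact: lt_le_trans rr0.
- by rewrite ballEmdist /=; exact: lt_le_trans rr0.
- have k0 : 0 <= `|k| by [].
  have er2 : eta ^+ 2 <= r ^+ 2 by rewrite ler_sqr ?nnegrE// ltW.
  have kr : 0 <= `|k| * r by rewrite mulr_ge0// ltW.
  have r14 : r <= 4^-1 by nra.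
  have kr14 : `|k| * r <= 4^-1 by nra.
  apply: (le_trans (ler_wpM2l k0 er2)); rewrite expr2 mulrA.
  by rewrite (le_trans (ler_piMr kr _))//; lra.
Qed.

Lemma shortest_fromE (q : M) (g : shortest_from q) (s t : R) :
  0 <= s <= curve_len g -> 0 <= t <= curve_len g -> mdist (g s) (g t) = `|s - t|.
Proof. by move=> sI tI; rewrite (proj2 (curve_shortest g))// in_itv. Qed.

Lemma shortest_from_mdist (q : M) (g : shortest_from q) (s : R) :
  0 <= s <= curve_len g -> mdist q (g s) = s.
Proof.
move=> sI; have := @shortest_fromE q g 0 s _ sI; rewrite curve_at0 => ->.
  by rewrite sub0r normrN ger0_norm//; case/andP: sI.
by rewrite lexx ltW ?curve_len_gt0.
Qed.

Lemma ray_comparison (q : M) (K r : R) (g : shortest_from q) (s lam eta : R) (b : M) :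
  almost_euclidean_near q K r -> 0 <= s -> s <= curve_len g -> s < r -> mdist q b < r ->
  eta <= r -> 0 <= lam <= 1 ->
  mdist q b <= eta -> mdist (g s) b <= eta -> mdist (g (lam * s)) b <= eta ->
  (1 - lam) * mdist q b ^+ 2 + lam * mdist (g s) b ^+ 2 - mdist (g (lam * s)) b ^+ 2 <=
  (1 + K * eta ^+ 2) * (lam * (1 - lam) * s ^+ 2).
Proof.
move=> ae s0 sl sr qb er l01 qbe gbe gse.
have sE : mdist q (g s) = s by rewrite shortest_from_mdist// s0.
have := ae q b (g s) g lam eta er _ qb _ _ (curve_at0 g) _ l01 qbe gbe.
rewrite sE (metric_sym b); apply => //.
- by rewrite mdistxx; exact: le_lt_trans s0 sr.
- split=> // u v; rewrite !in_itv/= => /andP[u0 us] /andP[v0 vs].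
  by rewrite shortest_fromE// ?u0 ?v0/= (le_trans _ sl).
Qed.

End local_comparison.

Section comparison_cosine.
Context {R : realType} {M : metricType R} {q : M}.
Implicit Types g h : shortest_from q.

Definition comparison_cos g h (s t : R) : R :=
  (s ^+ 2 + t ^+ 2 - mdist (g s) (h t) ^+ 2) / (2 * s * t).

Lemma comparison_cosC g h s t : comparison_cos g h s t = comparison_cos h g t s.
Proof.
rewrite /comparison_cos (metric_sym (g s)) (addrC (s ^+ 2)).
by have -> : 2 * s * t = 2 * t * s by ring.
Qed.

Lemma comparison_cosE g h s t : s != 0 -> t != 0 ->
  mdist (g s) (h t) ^+ 2 = s ^+ 2 + t ^+ 2 - 2 * s * t * comparison_cos g h s t.
Proof. by move=> s0 t0; rewrite /comparison_cos; field; rewrite s0 t0. Qed.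

Lemma mdist_rays g h s t : 0 < s <= curve_len g -> 0 < t <= curve_len h ->
  `|s - t| <= mdist (g s) (h t) <= s + t.
Proof.
move=> /andP[s0 sl] /andP[t0 tl].
have qs : mdist q (g s) = s by rewrite shortest_from_mdist// ltW.
have qt : mdist q (h t) = t by rewrite shortest_from_mdist// ltW.
apply/andP; split; first by rewrite -{1}qs -{1}qt mdist_lip.
by have := metric_triangle (g s) q (h t); rewrite (metric_sym (g s) q) qs qt.
Qed.

Lemma comparison_cos_itv g h s t : 0 < s <= curve_len g -> 0 < t <= curve_len h ->
  -1 <= comparison_cos g h s t <= 1.
Proof.
move=> sI tI; have /andP[d1 d2] := mdist_rays sI tI.
move: sI tI => /andP[s0 sl] /andP[t0 tl].
have st0 : 0 < 2 * s * t by rewrite !mulr_gt0.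
have d0 := mdist_ge0 (g s) (h t).
have sq1 : `|s - t| ^+ 2 <= mdist (g s) (h t) ^+ 2 by rewrite ler_sqr ?nnegrE.
have sq2 : mdist (g s) (h t) ^+ 2 <= (s + t) ^+ 2.
  by rewrite ler_sqr ?nnegrE// addr_ge0// ltW.
rewrite real_normK ?num_real// in sq1.
by rewrite /comparison_cos ler_pdivlMr// ler_pdivrMr// mul1r mulN1r; apply/andP; split; lra.
Qed.

Lemma comparison_angleE g h s t : 0 < s <= curve_len g -> 0 < t <= curve_len h ->
  comparison_angle q (g s) (h t) = acos (comparison_cos g h s t).
Proof.
move=> /andP[s0 sl] /andP[t0 tl]; rewrite /comparison_angle /comparison_cos.
by rewrite !shortest_from_mdist// ltW.
Qed.

(** Almost monotonicity of the comparison angle, obtained by comparison for the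
    point [g (lam * s)] on the side from [q] to [g s].  The error is small only
    as long as [s / t] remains bounded. *)
Lemma comparison_cos_shorten (K r : R) g h s t lam :
  0 <= K -> almost_euclidean_near q K r ->
  0 < s <= curve_len g -> 0 < t <= curve_len h -> s + t <= r -> 0 < lam <= 1 ->
  comparison_cos g h (lam * s) t <=
  comparison_cos g h s t + K * (s + t) ^+ 2 * (1 - lam) * (s / (2 * t)).
Proof.
move=> K0 ae sI tI str /andP[l0 l1].
have /andP[_ d2] := mdist_rays sI tI.
move: (sI) (tI) => /andP[s0 sl] /andP[t0 tl].
have lsI : 0 < lam * s <= curve_len g.
  by rewrite mulr_gt0//= (le_trans _ sl)// ler_piMl// ltW.
have /andP[_ d2'] := mdist_rays lsI tI.
have qt : mdist q (h t) = t by rewrite shortest_from_mdist// ltW.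
have lss : lam * s <= s by rewrite ler_piMl// ltW.
have := @ray_comparison _ _ q K r g s lam (s + t) (h t) ae (ltW s0) sl.
rewrite qt (ltW l0) l1 => /(_ _ _ str isT _ d2 _) H.
have {H}H : (1 - lam) * t ^+ 2 + lam * mdist (g s) (h t) ^+ 2 -
     mdist (g (lam * s)) (h t) ^+ 2 <=
     (1 + K * (s + t) ^+ 2) * (lam * (1 - lam) * s ^+ 2) by apply: H; lra.
have lst : 0 < 2 * (lam * s) * t by rewrite !mulr_gt0.
rewrite /comparison_cos ler_pdivrMr//.
have -> : ((s ^+ 2 + t ^+ 2 - mdist (g s) (h t) ^+ 2) / (2 * s * t) +
   K * (s + t) ^+ 2 * (1 - lam) * (s / (2 * t))) * (2 * (lam * s) * t) =
   lam * (s ^+ 2 + t ^+ 2 - mdist (g s) (h t) ^+ 2) +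
   K * (s + t) ^+ 2 * (lam * (1 - lam) * s ^+ 2).
  by field; rewrite !gt_eqF.
lra.
Qed.

End comparison_cosine.

Section acos_continuity.
Context {R : realType}.

Lemma acos_near (c e : R) : -1 <= c <= 1 -> 0 < e ->
  exists2 d, 0 < d & forall x, -1 <= x <= 1 -> `|x - c| < d -> `|acos x - acos c| < e.
Proof.
move=> cI e0; set th := acos c.
have /andP[th0 thpi] : 0 <= th <= pi by exact: acos_angle.
have cE : cos th = c by rewrite acosK// in_itv/= cI.
have up : exists2 d, 0 < d & forall x, -1 <= x <= 1 -> c - d < x -> acos x < th + e.
  have [big|small] := ltP pi (th + e).
    by exists 1 => // x xI _; rewrite (le_lt_trans _ big)// acos_lepi.
  exists (c - cos (th + e)).
    by rewrite subr_gt0 -cE ltr_cos ?in_itv/= ?ltrDl ?th0 ?thpi ?addr_ge0 ?(ltW e0).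
  move=> x xI; rewrite subKr => cx; rewrite ltNge; apply/negP => H.
  have := cos_nincr (addr_ge0 th0 (ltW e0)) H (acos_lepi xI).
  by rewrite acosK ?in_itv/= ?xI// leNgt cx.
have down : exists2 d, 0 < d & forall x, -1 <= x <= 1 -> x < c + d -> th - e < acos x.
  have [big|small] := ltP (th - e) 0.
    by exists 1 => // x xI _; rewrite (lt_le_trans big)// acos_ge0.
  exists (cos (th - e) - c).
    rewrite subr_gt0 -cE ltr_cos ?in_itv/= ?th0 ?thpi ?small//=.
      by rewrite ltrBlDr ltrDl.
    by rewrite lerBlDr (le_trans thpi)// lerDl ltW.
  move=> x xI; rewrite addrC subrK => cx; rewrite ltNge; apply/negP => H.
  have tep : th - e <= pi by rewrite lerBlDr (le_trans thpi)// lerDl ltW.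
  have := cos_nincr (acos_ge0 xI) H tep.
  by rewrite acosK ?in_itv/= ?xI// leNgt cx.
have [d1 d10 H1] := up; have [d2 d20 H2] := down.
exists (Num.min d1 d2); first by rewrite lt_min d10.
move=> x xI; rewrite lt_min => /andP[]; rewrite !ltr_norml => /andP[a b] /andP[a' b'].
have h1 : acos x < th + e by apply: H1 => //; lra.
have h2 : th - e < acos x by apply: H2 => //; lra.
by apply/andP; split; lra.
Qed.

End acos_continuity.

Section angle_existence.
Context {R : realType} {M : metricType R} {q : M}.
Variables (K r : R).
Hypotheses (K0 : 0 <= K) (r0 : 0 < r) (ae : almost_euclidean_near q K r).
Implicit Types g h : shortest_from q.

Let diag g h s := comparison_cos g h s s + 6 * K * s ^+ 2.

Let small g h s := [&& 0 < s, s <= curve_len g, s <= curve_len h & s + s <= r].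

Let smallW g h s t : 0 < s -> s <= t -> small g h t -> small g h s.
Proof. by move=> s0 st /and4P[t0 tg th tr]; apply/and4P; split => //; lra. Qed.

(** Corrected by a quadratic term the cosine of the comparison angle is
    monotone along the diagonal, since a bounded shortening of both sides
    changes it almost monotonically. *)
Let diag_half g h s lam : small g h s -> 2^-1 <= lam <= 1 ->
  diag g h (lam * s) <= diag g h s.
Proof.
move=> sm /andP[l2 l1]; have /and4P[s0 sg sh sr] := sm.
have l0 : 0 < lam by lra.
have lI : 0 < lam <= 1 by rewrite l0.
have ls : lam * s <= s by rewrite ler_piMl// ltW.
have ls0 : 0 < lam * s by rewrite mulr_gt0.
have sgI : 0 < s <= curve_len g by rewrite s0.
have shI : 0 < s <= curve_len h by rewrite s0.
have lsI : 0 < lam * s <= curve_len g by rewrite ls0 (le_trans ls).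
have c1 := comparison_cos_shorten K0 ae sgI shI sr lI.
have c2 : comparison_cos h g (lam * s) (lam * s) <= comparison_cos h g s (lam * s) +
    K * (s + lam * s) ^+ 2 * (1 - lam) * (s / (2 * (lam * s))).
  by apply: (comparison_cos_shorten K0 ae) => //; lra.
rewrite 2!(comparison_cosC h) in c2.
have e1 : K * (s + s) ^+ 2 * (1 - lam) * (s / (2 * s)) = 2 * K * s ^+ 2 * (1 - lam).
  by field; rewrite gt_eqF.
have e2 : K * (s + lam * s) ^+ 2 * (1 - lam) * (s / (2 * (lam * s))) <= 4 * K * s ^+ 2 * (1 - lam).
  have -> : K * (s + lam * s) ^+ 2 * (1 - lam) * (s / (2 * (lam * s))) =
      (K * s ^+ 2 * (1 - lam)) * ((1 + lam) ^+ 2 / (2 * lam)).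
    by field; rewrite !gt_eqF.
  have -> : 4 * K * s ^+ 2 * (1 - lam) = K * s ^+ 2 * (1 - lam) * 4 by ring.
  rewrite ler_wpM2l//; first by rewrite mulr_ge0 ?subr_ge0// mulr_ge0// sqr_ge0.
  by rewrite ler_pdivrMr ?mulr_gt0//; nra.
rewrite /diag exprMn.
have P0 : 0 <= K * s ^+ 2 * (1 - lam) by rewrite mulr_ge0 ?subr_ge0// mulr_ge0// sqr_ge0.
have : 0 <= K * s ^+ 2 * (1 - lam) * lam by rewrite mulr_ge0// ltW.
lra.
Qed.

Let diag_mono g h s t : 0 < s -> s <= t -> small g h t -> diag g h s <= diag g h t.
Proof.
move=> s0 st sm; have t0 : 0 < t by exact: lt_le_trans st.
pose lam := s / t.
have -> : s = lam * t by rewrite /lam divfK// gt_eqF.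
have l0 : 0 < lam by rewrite divr_gt0.
have l1 : lam <= 1 by rewrite ler_pdivrMr// mul1r.
have [n ln] : exists n, 2^-1 ^+ n <= lam.
  have [n _ /(_ n (leqnn n))/= H] : \forall n \near \oo, (2^-1 : R) ^+ n < lam.
    have : (2^-1 : R) ^+ n @[n --> \oo] --> 0 by apply: cvg_expr; rewrite ger0_norm; lra.
    by move=> /cvgr0Pnorm_lt/(_ _ l0)[N _ HN]; exists N => // k /HN/=; exact/le_lt_trans/ler_norm.
  by exists n; exact: ltW.
move: (lam) l0 l1 ln => {s s0 st lam} lam l0 l1 ln.
elim: n lam l0 l1 ln => [|n IH] lam l0 l1 ln.
  rewrite expr0 in ln; have -> : lam = 1 by apply/le_anti; rewrite l1.
  by rewrite mul1r.
have [l2|l2] := leP 2^-1 lam; first by rewrite diag_half// l2.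
have -> : lam * t = 2^-1 * ((2 * lam) * t) by field.
have l20 : 0 < 2 * lam by rewrite mulr_gt0.
have l21 : 2 * lam <= 1 by lra.
apply: (@le_trans _ _ (diag g h (2 * lam * t))).
  apply: diag_half; last by apply/andP; split; lra.
  by apply: smallW sm; rewrite ?mulr_gt0// ler_piMl// ltW.
apply: IH => //; rewrite exprS in ln.
by rewrite -(ler_pM2l (x := 2^-1))// mulrA mulVf// mul1r.
Qed.

(** For large [s / t] the lower bound comes from the triangle inequality through
    the point [g s'] rather than from comparison. *)
Let long_side g h s s' t : 0 < s' -> s' <= s -> t <= s' -> 0 < t ->
  s <= curve_len g -> t <= curve_len h ->
  comparison_cos g h s' t - t / (2 * s') <= comparison_cos g h s t.
Proof.
move=> s'0 s's ts t0 sg th; have s0 : 0 < s by exact: lt_le_trans s's.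
have sI : 0 < s <= curve_len g by rewrite s0.
have s'I : 0 < s' <= curve_len g by rewrite s'0 (le_trans s's).
have tI : 0 < t <= curve_len h by rewrite t0.
have /andP[a1 a2] := mdist_rays sI tI; have /andP[b1 b2] := mdist_rays s'I tI.
have tri : mdist (g s) (h t) <= (s - s') + mdist (g s') (h t).
  have := metric_triangle (g s) (g s') (h t).
  rewrite (@shortest_fromE _ _ q g s s') ?ger0_norm ?subr_ge0//.
    by rewrite (ltW s0).
  by rewrite (ltW s'0) (le_trans s's).
rewrite ger0_norm ?subr_ge0 ?(le_trans ts)// in a1.
rewrite ger0_norm ?subr_ge0// in b1.
move: a1 a2 b1 b2 tri; rewrite /comparison_cos.
move: (mdist (g s) (h t)) (mdist (g s') (h t)) => d d' a1 a2 b1 b2 tri.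
have l1 : - (d - s) / t <= (s ^+ 2 + t ^+ 2 - d ^+ 2) / (2 * s * t).
  rewrite ler_pdivlMr ?mulr_gt0//.
  have -> : - (d - s) / t * (2 * s * t) = - (d - s) * (2 * s) by field; rewrite gt_eqF.
  have : (d - s) ^+ 2 <= t ^+ 2.
    rewrite -[leLHS](real_normK (num_real _)) ler_sqr ?nnegrE// ?(ltW t0)//.
    by rewrite ler_norml; apply/andP; split; lra.
  lra.
have l2 : (s' ^+ 2 + t ^+ 2 - d' ^+ 2) / (2 * s' * t) - t / (2 * s') <= - (d' - s') / t.
  have -> : (s' ^+ 2 + t ^+ 2 - d' ^+ 2) / (2 * s' * t) - t / (2 * s') =
    (s' ^+ 2 - d' ^+ 2) / (2 * s') / t by field; rewrite !gt_eqF.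
  rewrite ler_pM2r ?invr_gt0// ler_pdivrMr ?mulr_gt0//.
  by have := sqr_ge0 (d' - s'); lra.
apply: (le_trans l2); apply: le_trans l1.
by rewrite ler_pM2r ?invr_gt0//; lra.
Qed.

Let diag_upper g h s t : 0 < t -> t <= s -> small g h s ->
  comparison_cos g h s t <= diag g h s.
Proof.
move=> t0 ts sm; have /and4P[s0 sg sh sr] := sm.
have sgI : 0 < s <= curve_len g by rewrite s0.
have shI : 0 < s <= curve_len h by rewrite s0.
have lI : 0 < t / s <= 1 by rewrite divr_gt0//= ler_pdivrMr// mul1r.
have := comparison_cos_shorten K0 ae shI sgI sr lI.
rewrite divfK ?gt_eqF// 2!(comparison_cosC h) => /le_trans; apply.
rewrite /diag lerD2l.
have -> : K * (s + s) ^+ 2 * (1 - t / s) * (s / (2 * s)) = 2 * K * (s ^+ 2 * (1 - t / s)).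
  by field; rewrite gt_eqF.
have /andP[l0 l1] := lI.
have : K * (s ^+ 2 * (1 - t / s)) <= K * s ^+ 2.
  by rewrite ler_wpM2l// ler_piMr ?sqr_ge0// gerBl ltW.
have : 0 <= K * s ^+ 2 by rewrite mulr_ge0// sqr_ge0.
lra.
Qed.

Let diag_lower g h s t (N : nat) : (0 < N)%N -> 0 < t -> t <= s ->
  s <= curve_len g -> t <= curve_len h -> N.+1%:R * t <= r ->
  diag g h t - 6 * K * t ^+ 2 - K * (N.+1%:R * t) ^+ 2 * N%:R - (2 * N%:R)^-1 <=
  comparison_cos g h s t.
Proof.
move=> N0 t0 ts sg th Nr.
have N1 : 1 <= N%:R :> R by rewrite ler1n.
have Np : 0 < N%:R :> R by rewrite ltr0n.
have s0 : 0 < s by exact: lt_le_trans ts.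
pose s' := Num.min s (N%:R * t).
have s's : s' <= s by rewrite ge_min lexx.
have s'N : s' <= N%:R * t by rewrite ge_min lexx orbT.
have ts' : t <= s' by rewrite le_min ts ler_peMl// ltW.
have s'0 : 0 < s' by exact: lt_le_trans ts'.
have step1 : comparison_cos g h s' t - (2 * N%:R)^-1 <= comparison_cos g h s t.
  have [sN|Ns] := leP s (N%:R * t).
    have -> : s' = s by rewrite /s'; apply/min_idPl.
    by rewrite gerBl invr_ge0 mulr_ge0// ltW.
  have s'E : s' = N%:R * t by rewrite /s'; apply/min_idPr/ltW.
  have := @long_side g h s s' t s'0 s's ts' t0 sg th.
  have -> // : t / (2 * s') = (2 * N%:R)^-1.
  by rewrite s'E; field; rewrite !gt_eqF.
have N1E : N.+1%:R = N%:R + 1 :> R by rewrite -natr1.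
have s'tr : s' + t <= N.+1%:R * t by rewrite N1E mulrDl mul1r lerD2r.
have s'I : 0 < s' <= curve_len g by rewrite s'0 (le_trans s's).
have tI : 0 < t <= curve_len h by rewrite t0.
have lI : 0 < t / s' <= 1 by rewrite divr_gt0//= ler_pdivrMr// mul1r.
have := comparison_cos_shorten K0 ae s'I tI (le_trans s'tr Nr) lI.
rewrite divfK ?gt_eqF// => step2.
have err : K * (s' + t) ^+ 2 * (1 - t / s') * (s' / (2 * t)) <= K * (N.+1%:R * t) ^+ 2 * N%:R.
  have /andP[l0 l1] := lI.
  have q1 : (s' + t) ^+ 2 <= (N.+1%:R * t) ^+ 2.
    by rewrite ler_sqr ?nnegrE// ?mulr_ge0 ?addr_ge0 ?ltW.
  have q2 : (1 - t / s') * (s' / (2 * t)) <= N%:R.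
    have -> : (1 - t / s') * (s' / (2 * t)) = (s' - t) / (2 * t).
      by field; rewrite !gt_eqF.
    rewrite ler_pdivrMr ?mulr_gt0//; have : 0 <= N%:R * t by rewrite mulr_ge0// ltW.
    lra.
  have q0 : 0 <= (1 - t / s') * (s' / (2 * t)).
    by apply: mulr_ge0; rewrite ?subr_ge0// divr_ge0 ?mulr_ge0// ltW.
  have := ler_wpM2l K0 (ler_pM (sqr_ge0 _) q0 q1 q2).
  by rewrite !mulrA.
rewrite /diag; lra.
Qed.

Let diagC g h s : diag g h s = diag h g s.
Proof. by rewrite /diag comparison_cosC. Qed.

Lemma comparison_cos_cvg g h : exists c : R, forall e, 0 < e ->
  exists2 d, 0 < d & forall s t, 0 < s < d -> 0 < t < d ->
    [/\ s <= curve_len g, t <= curve_len h & `|comparison_cos g h s t - c| < e].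
Proof.
pose s0 := Num.min (r / 2) (Num.min (curve_len g) (curve_len h)).
have s0p : 0 < s0 by rewrite !lt_min divr_gt0// !curve_len_gt0.
have s0g : s0 <= curve_len g by rewrite !ge_min lexx orbT.
have s0h : s0 <= curve_len h by rewrite !ge_min lexx !orbT.
have s0r : s0 + s0 <= r.
  have : s0 <= r / 2 by rewrite ge_min lexx.
  lra.
have sm0 : small g h s0 by apply/and4P.
clearbody s0.
pose D := [set diag g h s | s in [set s | small g h s]].
have hD : has_inf D.
  split; first by exists (diag g h s0), s0.
  exists (- 1) => _ /= [s /and4P[sp sg sh sr] <-].
  have /andP[c1 _] : -1 <= comparison_cos g h s s <= 1 by apply: comparison_cos_itv; rewrite sp.
  by rewrite (le_trans c1)// /diag lerDl mulr_ge0 ?sqr_ge0// mulr_ge0.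
exists (inf D) => e e0.
have [_ [s1 /= sm1 <-] diag1] := inf_adherent e0 hD.
have s1p : 0 < s1 by case/and4P : sm1.
have e3 : 0 < e / 3 by rewrite divr_gt0.
have [N N0 Ne] : exists2 N, (0 < N)%N & (2 * N%:R)^-1 < e / 3 :> R.
  exists (Num.bound (e / 3)^-1).+1 => //.
  rewrite invf_plt ?posrE ?mulr_gt0//.
  have i0 : 0 <= (e / 3)^-1 by rewrite invr_ge0 ltW.
  rewrite (lt_le_trans (archi_boundP i0))// -[(Num.bound _).+1%:R]natr1.
  have : 0 <= (Num.bound (e / 3)^-1)%:R :> R by [].
  lra.
pose C := 6 * K + K * N.+1%:R ^+ 2 * N%:R.
have C0 : 0 <= C by rewrite addr_ge0// ?mulr_ge0 ?sqr_ge0.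
pose d := Num.min (Num.min s0 s1) (Num.min (r / N.+1%:R) (Num.min 1 (e / 3 / (C + 1)))).
have C1 : 0 < C + 1 by rewrite ltr_wpDl.
exists d; first by rewrite !lt_min s0p s1p ltr01 !divr_gt0.
have lower (g1 h1 : shortest_from q) s t : (forall x, diag g1 h1 x = diag g h x) ->
    s <= curve_len g1 -> t <= curve_len h1 ->
    0 < t -> t < d -> t <= s -> inf D - e < comparison_cos g1 h1 s t.
  move=> dE sg th t0; rewrite !lt_min => /andP[/andP[ts0 ts1]] /and3P[tN t1 tC] ts.
  have Nr : N.+1%:R * t <= r by rewrite mulrC -ler_pdivlMr// ltW.
  have := diag_lower N0 t0 ts sg th Nr; rewrite dE.
  have smt : small g h t by apply: smallW sm0; rewrite ?ltW.
  have infD : inf D <= diag g h t by apply: ge_inf; [exact: hD.2 | exists t].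
  have tC' : C * t ^+ 2 <= e / 3.
    rewrite ltr_pdivlMr// in tC.
    have t2 : t ^+ 2 <= t by rewrite expr2 ler_piMl// ltW.
    by apply: (le_trans (ler_wpM2l C0 t2)); nra.
  have -> : diag g h t - 6 * K * t ^+ 2 - K * (N.+1%:R * t) ^+ 2 * N%:R - (2 * N%:R)^-1
    = diag g h t - C * t ^+ 2 - (2 * N%:R)^-1 by rewrite /C; ring.
  move: (N%:R) Ne => n Ne; lra.
have upper (g1 h1 : shortest_from q) s t : (forall x, diag g1 h1 x = diag g h x) ->
    (forall x, small g1 h1 x = small g h x) ->
    0 < t -> t <= s -> s < d -> comparison_cos g1 h1 s t < inf D + e.
  move=> dE smE t0 ts; rewrite !lt_min => /andP[/andP[ss0 ss1]] _.
  have sp : 0 < s by exact: lt_le_trans ts.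
  have sms : small g h s by apply: smallW sm1; rewrite ?ltW.
  have : comparison_cos g1 h1 s t <= diag g1 h1 s by apply: diag_upper; rewrite ?smE.
  move=> /le_lt_trans; apply; rewrite dE; apply: le_lt_trans diag1.
  by apply: diag_mono => //; exact: ltW.
have smC x : small h g x = small g h x by rewrite /small; congr (_ && _); rewrite andbCA.
move=> s t /andP[sp sd] /andP[tp td].
have sg : s <= curve_len g by rewrite (le_trans _ s0g)// ltW// (lt_le_trans sd)// !ge_min lexx.
have th : t <= curve_len h by rewrite (le_trans _ s0h)// ltW// (lt_le_trans td)// !ge_min lexx.
split => //; rewrite ltr_norml.
have [ts|/ltW st] := leP t s.
  have := lower g h s t (fun=> erefl) sg th tp td ts.
  by have := upper g h s t (fun=> erefl) (fun=> erefl) tp ts sd; lra.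
rewrite comparison_cosC.
have := lower h g t s (fun x => diagC h g x) th sg sp sd st.
by have := upper h g t s (fun x => diagC h g x) smC sp st td; lra.
Qed.

End angle_existence.

Section angle_pseudometric.
Context {R : realType} {M : metricType R} {q : M}.
Variables (K r : R).
Hypotheses (K0 : 0 <= K) (r0 : 0 < r) (ae : almost_euclidean_near q K r).
Implicit Types f g h : shortest_from q.

Lemma near_prod_at_right (P : R * R -> Prop) (d : R) : 0 < d ->
  (forall s t, 0 < s < d -> 0 < t < d -> P (s, t)) ->
  \forall st \near (0^'+, 0^'+), P st.
Proof.
move=> d0 H; exists ([set s | 0 < s < d], [set s | 0 < s < d]).
  by split; near=> s; apply/andP; split; near: s;
    [exact: nbhs_right_gt | exact: nbhs_right_lt
    |exact: nbhs_right_gt | exact: nbhs_right_lt].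
by move=> [s t] /= [sd td]; exact: H.
Unshelve. all: by end_near. Qed.

(** The limit in the definition of [angle] is a genuine one. *)
Lemma angleP g h : 0 <= angle g h <= pi /\
  forall e, 0 < e -> exists2 d, 0 < d & forall s t, 0 < s < d -> 0 < t < d ->
    [/\ s <= curve_len g, t <= curve_len h &
        `|comparison_cos g h s t - cos (angle g h)| < e].
Proof.
have [c cP] := comparison_cos_cvg K0 r0 ae g h.
have c1 : -1 <= c <= 1.
  have approx e : 0 < e -> -1 - e <= c <= 1 + e.
    move=> e0; have [d d0 dP] := cP e e0.
    have d2 : 0 < d / 2 < d by rewrite divr_gt0//= ltr_pdivrMr// ltr_pMr// ltr1n.
    have [sg th] := dP _ _ d2 d2; rewrite ltr_norml => /andP[a b].
    have /andP[x y] : -1 <= comparison_cos g h (d / 2) (d / 2) <= 1.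
      by apply: comparison_cos_itv; rewrite divr_gt0.
    by apply/andP; split; lra.
  apply/andP; split; apply/ler_addgt0Pl => e /approx/andP[a b]; lra.
have aE : angle g h = acos c.
  apply/cvg_lim; first exact: Rhausdorff.
  apply/cvgrPdist_lt => e e0; have [d d0 dP] := acos_near c1 e0.
  have [d' d'0 d'P] := cP d d0.
  apply: (near_prod_at_right d'0) => s t sd td /=.
  have [sg th cst] := d'P _ _ sd td.
  have sI : 0 < s <= curve_len g by case/andP: sd => ->.
  have tI : 0 < t <= curve_len h by case/andP: td => ->.
  by rewrite distrC comparison_angleE// dP// comparison_cos_itv.
rewrite aE; split; first exact: acos_angle.
by rewrite acosK ?in_itv.
Qed.

Lemma angle_itv g h : 0 <= angle g h <= pi.
Proof. by have [] := angleP g h. Qed.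

Lemma angle_sym g h : angle g h = angle h g.
Proof.
have [/andP[a0 api] aP] := angleP g h; have [/andP[b0 bpi] bP] := angleP h g.
apply: cos_inj; rewrite ?in_itv/= ?a0 ?b0//.
apply/eqP; rewrite -subr_eq0 -normr_le0; apply/ler_addgt0Pl => e e0.
have e2 : 0 < e / 2 by rewrite divr_gt0.
have [d d0 dP] := aP _ e2; have [d' d'0 d'P] := bP _ e2.
pose s := Num.min d d' / 2.
have m0 : 0 < Num.min d d' by rewrite lt_min d0.
have sm : s < Num.min d d' by rewrite ltr_pdivrMr// ltr_pMr// ltr1n.
have s0 : 0 < s by rewrite divr_gt0.
have sd : 0 < s < d by rewrite s0 (lt_le_trans sm)// ge_min lexx.
have sd' : 0 < s < d' by rewrite s0 (lt_le_trans sm)// ge_min lexx orbT.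
have [_ _] := dP _ _ sd sd; have [_ _] := d'P _ _ sd' sd'.
rewrite (comparison_cosC h) ler_norml !ltr_norml => /andP[a b] /andP[c e'].
by apply/andP; split; lra.
Qed.

(** This is how angles enter metric arguments: at a small scale [t] two rays
    look like rays of the Euclidean cone, whatever the fixed ratio [a / b]. *)
Lemma rays_mdist g h (a b e : R) : 0 < a -> 0 < b -> 0 < e ->
  exists2 d, 0 < d & forall t, 0 < t < d -> [/\ a * t <= curve_len g, b * t <= curve_len h &
    `|mdist (g (a * t)) (h (b * t)) ^+ 2
      - (a ^+ 2 + b ^+ 2 - 2 * a * b * cos (angle g h)) * t ^+ 2| <= e * t ^+ 2].
Proof.
move=> a0 b0 e0; have [_ aP] := angleP g h.
have e1 : 0 < e / (2 * a * b) by rewrite divr_gt0// !mulr_gt0.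
have [d d0 dP] := aP _ e1.
exists (Num.min (d / a) (d / b)); first by rewrite lt_min !divr_gt0.
move=> t /andP[t0]; rewrite lt_min !ltr_pdivlMr// => /andP[ta tb].
have sa : 0 < a * t < d by rewrite mulr_gt0//= mulrC.
have sb : 0 < b * t < d by rewrite mulr_gt0//= mulrC.
have [ag bh H] := dP _ _ sa sb; split => //.
rewrite (@comparison_cosE _ _ _ g h) ?gt_eqF ?mulr_gt0//.
rewrite [X in `|X|](_ : _ = - (2 * a * b * t ^+ 2) *
    (comparison_cos g h (a * t) (b * t) - cos (angle g h))); last by ring.
have P0 : 0 < 2 * a * b * t ^+ 2 by rewrite !mulr_gt0 ?exprn_gt0.
rewrite normrM normrN (gtr0_norm P0).
have -> : e * t ^+ 2 = 2 * a * b * t ^+ 2 * (e / (2 * a * b)).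
  by field; rewrite !gt_eqF.
by rewrite ler_pM2l ?ltW.
Qed.

Lemma triangle_limit (A B C : R) : 0 <= A -> 0 <= B -> 0 <= C ->
  (forall e, 0 < e -> exists x y z, [/\ 0 <= x, 0 <= y, 0 <= z & [/\ z <= x + y,
     x ^+ 2 <= A ^+ 2 + e, y ^+ 2 <= B ^+ 2 + e & C ^+ 2 - e <= z ^+ 2]]) -> C <= A + B.
Proof.
move=> A0 B0 C0 H; rewrite leNgt; apply/negP => ABC.
pose n := (C - A - B) / 4.
have n0 : 0 < n by rewrite divr_gt0//; lra.
have [x [y [z [x0 y0 z0 [zxy xA yB zC]]]]] := H _ (exprn_gt0 2 n0).
have x1 : x <= A + n.
  rewrite -ler_sqr ?nnegrE ?addr_ge0 ?(ltW n0)// (le_trans xA)// sqrrD lerD2r lerDl.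
  by rewrite mulrn_wge0// mulr_ge0// ltW.
have y1 : y <= B + n.
  rewrite -ler_sqr ?nnegrE ?addr_ge0 ?(ltW n0)// (le_trans yB)// sqrrD lerD2r lerDl.
  by rewrite mulrn_wge0// mulr_ge0// ltW.
have Cn : 4 * n <= C by rewrite /n; lra.
have z1 : C - n <= z.
  rewrite -ler_sqr ?nnegrE ?(le_trans _ zC)//; first by nra.
  lra.
have : 4 * n = C - A - B by rewrite /n; field.
lra.
Qed.

(** If the two outer rays spanned more than the sum of the angles, the chord
    between them at distance [t] would be longer than the path over the point
    of the middle ray where the corresponding planar chord crosses it. *)
Lemma angle_triangle f g h : angle f h <= angle f g + angle g h.
Proof.
have /andP[a0 api] := angle_itv f g; have /andP[b0 bpi] := angle_itv g h.
have /andP[c0 cpi] := angle_itv f h.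
have [big|small] := leP pi (angle f g + angle g h); first exact: le_trans big.
set a := angle f g in a0 api small *; set b := angle g h in b0 bpi small *.
set c := angle f h in c0 cpi *.
pose phi := (a + b) / 2; pose psi := (a - b) / 2.
have cphi : 0 < cos phi by apply: cos_gt0_pihalf; rewrite /phi; apply/andP; split; lra.
have cpsi : 0 < cos psi by apply: cos_gt0_pihalf; rewrite /psi; apply/andP; split; lra.
(* The planar chord between unit points on the outer rays meets the ray at
   angle [a] at distance [rho] from the origin, which divides it into pieces of
   lengths [sin a / cos psi] and [sin b / cos psi]. *)
pose rho := cos phi / cos psi.
have rho0 : 0 < rho by rewrite divr_gt0.
have sphi : 0 <= sin phi by apply: sin_ge0_pi; rewrite /phi; apply/andP; split; lra.
have aE : a = phi + psi by rewrite /phi /psi; field.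
have bE : b = phi - psi by rewrite /phi /psi; field.
have pythag : cos phi ^+ 2 = 1 - sin phi ^+ 2 by rewrite -(cos2Dsin2 phi); ring.
have pythag' : sin psi ^+ 2 = 1 - cos psi ^+ 2 by rewrite -(cos2Dsin2 psi); ring.
have pythag2 : cos psi ^+ 2 + cos phi ^+ 2 - 2 * cos phi ^+ 2 * cos psi ^+ 2 =
    sin phi ^+ 2 * cos psi ^+ 2 + cos phi ^+ 2 * sin psi ^+ 2.
  by rewrite pythag pythag'; ring.
have E1 : 1 ^+ 2 + rho ^+ 2 - 2 * 1 * rho * cos a = (sin a / cos psi) ^+ 2.
  rewrite /rho aE cosD sinD.
  have -> : 1 ^+ 2 + (cos phi / cos psi) ^+ 2 - 2 * 1 * (cos phi / cos psi) *
      (cos phi * cos psi - sin phi * sin psi) =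
      (cos psi ^+ 2 + cos phi ^+ 2 - 2 * cos phi ^+ 2 * cos psi ^+ 2
       + 2 * cos phi * cos psi * sin phi * sin psi) / cos psi ^+ 2.
    by field; rewrite gt_eqF.
  by rewrite pythag2; field; rewrite gt_eqF.
have E2 : rho ^+ 2 + 1 ^+ 2 - 2 * rho * 1 * cos b = (sin b / cos psi) ^+ 2.
  rewrite /rho bE cosB sinB.
  have -> : (cos phi / cos psi) ^+ 2 + 1 ^+ 2 - 2 * (cos phi / cos psi) * 1 *
      (cos phi * cos psi + sin phi * sin psi) =
      (cos psi ^+ 2 + cos phi ^+ 2 - 2 * cos phi ^+ 2 * cos psi ^+ 2
       - 2 * cos phi * cos psi * sin phi * sin psi) / cos psi ^+ 2.
    by field; rewrite gt_eqF.
  by rewrite pythag2; field; rewrite gt_eqF.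
have E3 : 1 ^+ 2 + 1 ^+ 2 - 2 * 1 * 1 * cos c = (2 * sin (c / 2)) ^+ 2.
  have -> : cos c = 1 - 2 * sin (c / 2) ^+ 2.
    rewrite [in LHS](splitr c) cosD -!expr2.
    by rewrite cos2sin2; ring.
  by ring.
have sa : 0 <= sin a / cos psi by rewrite divr_ge0 ?(ltW cpsi)// sin_ge0_pi// a0.
have sb : 0 <= sin b / cos psi by rewrite divr_ge0 ?(ltW cpsi)// sin_ge0_pi// b0.
have sc : 0 <= 2 * sin (c / 2).
  by rewrite mulr_ge0// sin_ge0_pi//; apply/andP; split; lra.
have := triangle_limit sa sb sc.
have -> : sin a / cos psi + sin b / cos psi = 2 * sin phi.
  by rewrite aE bE sinD sinB; field; rewrite gt_eqF.
move=> chord; have {}chord : 2 * sin (c / 2) <= 2 * sin phi.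
  apply: chord => e e0.
  have [d1 d10 P1] := rays_mdist f g ltr01 rho0 e0.
  have [d2 d20 P2] := rays_mdist g h rho0 ltr01 e0.
  have [d3 d30 P3] := rays_mdist f h ltr01 ltr01 e0.
  pose m := Num.min d1 (Num.min d2 d3).
  have m0 : 0 < m by rewrite !lt_min d10 d20.
  pose t := m / 2.
  have t0 : 0 < t by rewrite divr_gt0.
  have : t < m by rewrite ltr_pdivrMr// ltr_pMr// ltr1n.
  rewrite !lt_min => /and3P[t1 t2 t3]; clearbody t.
  have [|_ _] := P1 t; first by rewrite t0.
  have [|_ _] := P2 t; first by rewrite t0.
  have [|_ _] := P3 t; first by rewrite t0.
  rewrite -/a -/b -/c E1 E2 E3 mul1r.
  have tri := metric_triangle (f t) (g (rho * t)) (h t).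
  move: tri (mdist_ge0 (f t) (g (rho * t))) (mdist_ge0 (g (rho * t)) (h t)) (mdist_ge0 (f t) (h t)).
  move: (mdist (f t) (g _)) (mdist (g _) (h t)) (mdist (f t) (h t)) => x y z.
  move=> tri x0 y0 z0; rewrite !ler_norml => /andP[z1 _] /andP[_ y1] /andP[_ x1].
  have t20 : 0 < t ^+ 2 by rewrite exprn_gt0.
  have scale u : (u / t) ^+ 2 = u ^+ 2 / t ^+ 2 by rewrite expr_div_n.
  exists (x / t), (y / t), (z / t); split; [| | |split]; rewrite ?divr_ge0 ?(ltW t0)//.
  - by rewrite -mulrDl ler_pM2r ?invr_gt0.
  - by rewrite scale ler_pdivrMr// mulrDl; lra.
  - by rewrite scale ler_pdivrMr// mulrDl; lra.
  - by rewrite scale ler_pdivlMr// mulrBl; lra.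
rewrite ler_pM2l// in chord.
suff : c / 2 <= phi by rewrite /phi; lra.
rewrite leNgt; apply/negP => phic; move: chord; rewrite leNgt ltr_sin ?phic//.
  by rewrite in_itv/=; apply/andP; split; lra.
by rewrite in_itv/= /phi; apply/andP; split; lra.
Qed.

End angle_pseudometric.

(** * The tangent cone is spanned by directions of shortest curves *)

Section completion_density.
Context {R : realType} (T : Type) (d : T -> T -> R).
Hypotheses (dxx : forall x, d x x = 0) (d0 : forall x y, 0 <= d x y)
  (dC : forall x y, d x y = d y x) (dD : forall x y z, d x z <= d x y + d y z).

Let d_lip x y z : `|d x y - d x z| <= d y z.
Proof.
have := dD x y z; have := dD x z y; rewrite (dC z y).
by rewrite ler_norml => a b; apply/andP; split; lra.
Qed.

Lemma seq_dist_cvg u v : cauchy_seq d u -> cauchy_seq d v ->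
  cvg (d (u n) (v n) @[n --> \oo]).
Proof.
move=> cu cv; apply: cauchy_cvg; apply: cauchy_exP => e e0.
have e2 : 0 < e / 2 by rewrite divr_gt0.
have [N1 H1] := cu _ e2; have [N2 H2] := cv _ e2.
pose N := maxn N1 N2; exists (d (u N) (v N)).
exists N => // n /= Nn; rewrite /ball/=.
have h1 : d (u N) (u n) < e / 2 by apply: H1; rewrite ?leq_maxl// (leq_trans (leq_maxl _ _) Nn).
have h2 : d (v N) (v n) < e / 2 by apply: H2; rewrite ?leq_maxr// (leq_trans (leq_maxr _ _) Nn).
have l1 := d_lip (u N) (v N) (v n); have l2 := d_lip (v n) (u N) (u n).
rewrite (dC (v n)) (dC (v n)) in l2.
by move: l1 l2; rewrite ltr_norml !ler_norml => /andP[a b] /andP[a' b']; apply/andP; split; lra.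
Qed.

Lemma completion_dense (A : completion d) (e : R) : 0 < e ->
  exists x, 0 <= completion_dist A (to_completion dxx x) <= e.
Proof.
move=> e0; rewrite /completion_dist.
have reprP (B : completion d) : cauchy_seq d (completion_repr B) /\
    proj1_sig B = cauchy_class d (completion_repr B).
  exact: (proj2_sig (cid (proj2_sig B))).
have [cu _] := reprP A; move: (completion_repr A) cu => u cu.
have e2 : 0 < e / 2 by rewrite divr_gt0.
have [N HN] := cu _ e2; exists (u N).
set B := to_completion _ _.
have [cv BE] := reprP B; move: (completion_repr B) cv BE => v cv BE.
have [_ dv] : (proj1_sig B) v.
  rewrite BE; split => //; rewrite /seq_dist.
  by under eq_fun do rewrite dxx; exact: lim_cst.
have cst : cauchy_seq d (fun=> u N) by exact: cauchy_seq_cst.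
have vN : \forall n \near \oo, d (u N) (v n) < e / 2.
  have /cvgrPdist_lt/(_ _ e2) := seq_dist_cvg cst cv.
  rewrite -/(seq_dist d (fun=> u N) v) dv; apply: filterS => n.
  by rewrite sub0r normrN ger0_norm.
have cuv := seq_dist_cvg cu cv.
apply/andP; split.
  by apply: limr_ge => //; apply: nearW => n.
apply: limr_le => //; near=> n.
have : d (u n) (u N) < e / 2 by apply: HN => //; near: n; exact: nbhs_infty_ge.
have : d (u N) (v n) < e / 2 by near: n.
by have := dD (u n) (u N) (v n); lra.
Unshelve. all: by end_near. Qed.

End completion_density.

Section tangent_density.
Context {R : realType} {M : metricType R} {q : M}.
Variables (K r : R).
Hypotheses (K0 : 0 <= K) (r0 : 0 < r) (ae : almost_euclidean_near q K r).

Lemma unit_cone_dist_small (e : R) : 0 < e -> exists2 d, 0 < d &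
  forall t, 0 <= t <= d -> Num.sqrt (1 ^+ 2 + 1 ^+ 2 - 2 * 1 * 1 * cos (Num.min t pi)) < e.
Proof.
move=> e0; have pi0 := pi_gt0 R; exists (e / 2); first by rewrite divr_gt0.
move=> t /andP[t0 te].
pose u := Num.min t pi; rewrite -/u.
have u0 : 0 <= u by rewrite le_min t0 ltW.
have ut : u <= t by rewrite ge_min lexx.
have := cos_ge_quad u0 => cu.
have : Num.sqrt (1 ^+ 2 + 1 ^+ 2 - 2 * 1 * 1 * cos u) <= Num.sqrt (u ^+ 2).
  by rewrite ler_wsqrtr//; lra.
move=> /le_lt_trans; apply; rewrite sqrtr_sqr ger0_norm//.
lra.
Qed.

(** Velocities are the unit vectors over a dense subset of the space of
    directions. *)
Lemma differential_eq0 (D : tangent_cone q -> R) :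
  tangent_continuous D -> positively_homogeneous D ->
  (forall g : shortest_from q, D (velocity g) = 0) -> forall v, D v = 0.
Proof.
move=> Dc Dh Dg.
have apex0 : D apex = 0.
  by have := Dh (PosNum (ltr0n R 2)) apex; rewrite /=; lra.
have unit0 (x : space_of_directions q) : D (ray 1%:pos x) = 0.
  apply/eqP; rewrite -normr_le0; apply/ler_addgt0Pl => e e0; rewrite addr0.
  have [s s0 sP] := Dc (ray 1%:pos x) e e0.
  have [d d0 dP] := unit_cone_dist_small s0.
  have a0 (g h : shortest_from q) : 0 <= angle g h by have /andP[] := angle_itv K0 r0 ae g h.
  have [g gP] := completion_dense (@anglexx R M q) a0 (angle_sym K0 r0 ae)
    (fun f g h => angle_triangle K0 r0 ae f g h) x d0.
  have := sP (velocity g); rewrite Dg subr0 => H; apply/ltW/H.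
  exact: dP.
case=> [//|t x].
have -> : ray t x = cone_scale t (ray 1%:pos x).
  by rewrite /=; congr ray; apply/val_inj; rewrite /= mulr1.
by rewrite Dh unit0 mulr0.
Qed.

End tangent_density.

(** * Semiconcavity of squared distances and of the Frechet function *)

Definition geodesic_space {R : realType} (M : metricType R) : Prop :=
  forall x y : M, exists g,
    [/\ shortest_curve (mdist x y) g, g 0 = x & g (mdist x y) = y].

Section semiconcavity.
Context {R : realType} {M : metricType R} {q : M}.
Variables (K r : R).
Hypotheses (K0 : 0 <= K) (r0 : 0 < r) (ae : almost_euclidean_near q K r).
Hypothesis geo : geodesic_space M.

(** The comparison is only local, but semiconcavity along small segments holds
    for the distance from an arbitrarily remote point [x]: by the triangle
    inequality it is inherited from the distance from a point at controlled
    distance on a shortest curve towards [x]. *)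
Lemma sq_dist_semiconcave (x a c : M) (g : R -> M) (lam : R) :
  mdist q a <= r / 6 -> mdist q c <= r / 6 ->
  shortest_curve (mdist a c) g -> g 0 = a -> g (mdist a c) = c ->
  0 <= lam <= 1 ->
  (1 - lam) * mdist a x ^+ 2 + lam * mdist c x ^+ 2
    - mdist (g (lam * mdist a c)) x ^+ 2 <=
  (1 + K * r ^+ 2) * (3 + 3 / r * mdist q x) * (lam * (1 - lam) * mdist a c ^+ 2).
Proof.
move=> qa qc gs g0 gL l01; have /andP[l0 l1] := l01; have rp := r0.
set L := mdist a c in gs gL *.
have L0 : 0 <= L by exact: mdist_ge0.
have L3 : L <= r / 3.
  by have := metric_triangle a q c; rewrite (metric_sym a q) -/L; lra.
pose tau := lam * L; rewrite -/tau.
have tau0 : 0 <= tau by rewrite mulr_ge0.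
have tauL : tau <= L by rewrite ler_piMl.
set m := g tau.
have am : mdist a m = tau.
  by rewrite /m -{1}g0 (proj2 gs) ?in_itv/= ?lexx ?L0 ?tau0// sub0r normrN ger0_norm.
have cm : mdist c m = L - tau.
  by rewrite /m -{1}gL (proj2 gs) ?in_itv/= ?lexx ?L0 ?tau0// ger0_norm ?subr_ge0.
have qm : mdist q m <= r / 2.
  by have := metric_triangle q a m; lra.
set kappa := 1 + K * r ^+ 2.
have kappa1 : 1 <= kappa by rewrite lerDl mulr_ge0// sqr_ge0.
pose P := lam * (1 - lam) * L ^+ 2; rewrite -/P.
have P0 : 0 <= P by rewrite !mulr_ge0 ?subr_ge0// sqr_ge0.
have local y : mdist m y <= r / 3 ->
    (1 - lam) * mdist a y ^+ 2 + lam * mdist c y ^+ 2 - mdist m y ^+ 2 <= kappa * P.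
  move=> my; rewrite (metric_sym m y) /m.
  have ay := metric_triangle a m y; have cy := metric_triangle c m y.
  have qy := metric_triangle q m y.
  by apply: (ae (eta := r)) => //; rewrite -/L -/tau -/m ?(metric_sym y m); lra.
set D := mdist m x.
have D0 : 0 <= D by exact: mdist_ge0.
have Dq : D <= r / 2 + mdist q x.
  by have := metric_triangle m q x; rewrite (metric_sym m q) -/D; lra.
have q0 := mdist_ge0 q x.
have r3 : 0 < 3 / r by rewrite divr_gt0.
have Dr : D * (3 / r) <= 3 / 2 + 3 / r * mdist q x.
  rewrite mulrC (le_trans (ler_wpM2l (ltW r3) Dq))// mulrDr lerD2r.
  by rewrite le_eqVlt; apply/orP; left; apply/eqP; field; rewrite gt_eqF.
have kP0 : 0 <= kappa * P by rewrite mulr_ge0// (le_trans ler01).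
suff main : (1 - lam) * mdist a x ^+ 2 + lam * mdist c x ^+ 2 - D ^+ 2 <=
    (1 + D * (3 / r)) * (kappa * P).
  apply: (le_trans main); rewrite [leRHS](_ : _ = (3 + 3 / r * mdist q x) * (kappa * P)); last by ring.
  by rewrite ler_wpM2r//; lra.
have [Dsmall|Dbig] := leP D (r / 3).
  apply: (le_trans (local x Dsmall)).
  by rewrite ler_peMl// lerDl mulr_ge0// ltW.
pose rho := r / 3; rewrite -/rho in Dbig.
have rho0 : 0 < rho by rewrite divr_gt0.
have [h [hs h0 hD]] := geo m x.
pose y := h rho.
have my : mdist m y = rho.
  rewrite /y -{1}h0 (proj2 hs) ?in_itv/= ?lexx ?D0 ?(ltW rho0) ?(ltW Dbig)//.
  by rewrite sub0r normrN gtr0_norm.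
have yx : mdist y x = D - rho.
  rewrite /y -{1}hD (proj2 hs) ?in_itv/= ?lexx ?D0 ?(ltW rho0) ?(ltW Dbig)//.
  by rewrite distrC gtr0_norm ?subr_gt0.
have := local y; rewrite my /rho => /(_ (lexx _)); rewrite -/rho => loc.
have ayx := metric_triangle a y x; have cyx := metric_triangle c y x.
have amx := mdist_lip x a m; have cmx := mdist_lip x c m.
rewrite am !(metric_sym x) -/D ler_norml in amx.
rewrite cm !(metric_sym x) -/D ler_norml in cmx.
move: amx cmx => /andP[am1 am2] /andP[cm1 cm2].
move: ayx cyx loc am1 am2 cm1 cm2; rewrite yx.
move: (mdist a x) (mdist c x) (mdist a y) (mdist c y) => A B A' B'.
move=> ay cy loc am1 am2 cm1 cm2.
pose al := A - D; pose be := B - D.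
have m0 : 0 <= 1 - lam by rewrite subr_ge0.
have ral : 0 <= rho + al by rewrite /al /rho; lra.
have rbe : 0 <= rho + be by rewrite /be /rho; lra.
have A2 : (rho + al) ^+ 2 <= A' ^+ 2.
  have A1 : rho + al <= A' by rewrite /al; lra.
  by rewrite ler_sqr ?nnegrE// (le_trans ral).
have B2 : (rho + be) ^+ 2 <= B' ^+ 2.
  have B1 : rho + be <= B' by rewrite /be; lra.
  by rewrite ler_sqr ?nnegrE// (le_trans rbe).
have al2 : al ^+ 2 <= tau ^+ 2.
  rewrite -[leLHS](real_normK (num_real _)) ler_sqr ?nnegrE// ler_norml /al.
  by apply/andP; split; lra.
have be2 : be ^+ 2 <= (L - tau) ^+ 2.
  rewrite -[leLHS](real_normK (num_real _)) ler_sqr ?nnegrE ?subr_ge0// ler_norml /be.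
  by apply/andP; split; lra.
have quad : (1 - lam) * al ^+ 2 + lam * be ^+ 2 <= P.
  have := lerD (ler_wpM2l m0 al2) (ler_wpM2l l0 be2).
  by rewrite /P /tau; lra.
have lin : 2 * rho * ((1 - lam) * al + lam * be) <= kappa * P.
  have := lerD (ler_wpM2l m0 A2) (ler_wpM2l l0 B2).
  have := addr_ge0 (mulr_ge0 m0 (sqr_ge0 al)) (mulr_ge0 l0 (sqr_ge0 be)).
  lra.
have lin2 : 2 * D * ((1 - lam) * al + lam * be) <= D * (3 / r) * (kappa * P).
  have -> : 2 * D * ((1 - lam) * al + lam * be) =
     D * (3 / r) * (2 * rho * ((1 - lam) * al + lam * be)).
    by rewrite /rho; field; rewrite gt_eqF.
  by rewrite ler_wpM2l// mulr_ge0// ltW.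
have : P <= kappa * P by rewrite ler_peMl.
move: quad lin2; rewrite /al /be; lra.
Qed.

End semiconcavity.

Section frechet_function.
Context {R : realType} {M : completeMetricType R} (Q : probability (borel M) R).
Hypothesis fsm : finite_second_moment Q.
Implicit Types p q x : M.

Lemma measurable_mdist q : measurable_fun setT (mdist q : borel M -> R).
Proof.
apply: (measurability _ (RGenOpens.measurableE R)) => //.
move=> _ [_ [a [b ->] <-]]; rewrite setTI.
apply: sub_sigma_algebra.
by move/continuousP : (@mdist_continuous R M q); apply; exact: interval_open.
Qed.

Lemma integrable_fun_cst (c : R) : Q.-integrable setT (EFin \o cst c).
Proof.
exact: (finite_measure_integrable_cst Q c measurableT).
Qed.

Lemma integrable_scale (k : R) (f : borel M -> R) : Q.-integrable setT (EFin \o f) ->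
  Q.-integrable setT (EFin \o (fun x => k * f x)).
Proof. by move=> fi; exact: (integrableZl measurableT k fi). Qed.

Lemma integrable_add (f g : borel M -> R) : Q.-integrable setT (EFin \o f) ->
  Q.-integrable setT (EFin \o g) -> Q.-integrable setT (EFin \o (fun x => f x + g x)).
Proof. by move=> fi gi; exact: (integrableD measurableT fi gi). Qed.

Lemma integrable_sub (f g : borel M -> R) : Q.-integrable setT (EFin \o f) ->
  Q.-integrable setT (EFin \o g) -> Q.-integrable setT (EFin \o (fun x => f x - g x)).
Proof. by move=> fi gi; exact: (integrableB measurableT fi gi). Qed.

Lemma measurable_sq_mdist q :
  measurable_fun setT ((fun x => mdist q x ^+ 2) : borel M -> R).
Proof.
by apply: measurable_funX; exact: measurable_mdist.
Qed.

Lemma integrable_dominated (f : borel M -> R) (p : M) (a b : R) :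
  Q.-integrable setT (EFin \o (fun x : borel M => mdist p x ^+ 2)) ->
  measurable_fun setT f -> (forall x, `|f x| <= a + b * mdist p x ^+ 2) ->
  Q.-integrable setT (EFin \o f).
Proof.
move=> ip mf fab.
have iab : Q.-integrable setT (EFin \o (fun x : borel M => a + b * mdist p x ^+ 2)).
  by apply: integrable_add; [exact: integrable_fun_cst | exact: integrable_scale].
apply: le_integrable iab => //; first exact/measurable_EFinP.
move=> x _ /=; rewrite lee_fin (le_trans (fab x))//.
exact: ler_norm.
Qed.

Lemma integrable_sq_mdist q :
  Q.-integrable setT (EFin \o (fun x : borel M => mdist q x ^+ 2)).
Proof.
have [p pfin] := fsm.
have ip : Q.-integrable setT (EFin \o (fun x : borel M => mdist p x ^+ 2)).
  apply/integrableP; split; first by apply/measurable_EFinP; exact: measurable_sq_mdist.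
  apply: le_lt_trans pfin; rewrite le_eqVlt; apply/orP; left; apply/eqP.
  by apply: eq_integral => x _ /=; rewrite ger0_norm ?sqr_ge0.
apply: (integrable_dominated (a := 2 * mdist q p ^+ 2) (b := 2) ip).
  exact: measurable_sq_mdist.
move=> x; rewrite ger0_norm ?sqr_ge0//.
move: (metric_triangle q p x) (mdist_ge0 q x).
move: (mdist q x) (mdist q p) (mdist p x) => u v w uvw u0.
have : u ^+ 2 <= (v + w) ^+ 2 by rewrite ler_sqr ?nnegrE// (le_trans u0).
by have := sqr_ge0 (v - w); lra.
Qed.

Lemma integrable_mdist q : Q.-integrable setT (EFin \o (mdist q : borel M -> R)).
Proof.
apply: (integrable_dominated (a := 1) (b := 1) (integrable_sq_mdist q)).
  exact: measurable_mdist.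
move=> x; rewrite ger0_norm ?mdist_ge0//.
move: (mdist q x) => u; have := sqr_ge0 (u - 1); have := sqr_ge0 u; lra.
Qed.

Let F := frechet_function Q.
Let E1 q : R := \int[Q]_x mdist q x.

Lemma Rintegral_probability_cst (c : R) : \int[Q]_x c = c.
Proof.
rewrite Rintegral_cst// [X in _ * fine X](_ : _ = 1%E) ?mulr1//.
exact: probability_setT.
Qed.

Lemma frechet_semiconcave (q : M) (K r : R) (a c : M) (g : R -> M) (lam : R) :
  0 <= K -> 0 < r -> almost_euclidean_near q K r -> geodesic_space M ->
  mdist q a <= r / 6 -> mdist q c <= r / 6 ->
  shortest_curve (mdist a c) g -> g 0 = a -> g (mdist a c) = c ->
  0 <= lam <= 1 ->
  (1 - lam) * F a + lam * F c - F (g (lam * mdist a c)) <=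
  (1 + K * r ^+ 2) * (3 + 3 / r * E1 q) * (lam * (1 - lam) * mdist a c ^+ 2).
Proof.
move=> K0 r0 ae geo qa qc gs g0 gL l01.
set m := g _; set P := lam * _ * _.
have main x := sq_dist_semiconcave K0 r0 ae geo x qa qc gs g0 gL l01.
rewrite -/m -/P in main.
have Zl p (k : R) : Q.-integrable setT (EFin \o (fun x : borel M => k * mdist p x ^+ 2)).
  by apply: integrable_scale; exact: integrable_sq_mdist.
have lhsE : (1 - lam) * F a + lam * F c - F m =
    \int[Q]_x ((1 - lam) * mdist a x ^+ 2 + lam * mdist c x ^+ 2 - mdist m x ^+ 2).
  rewrite RintegralB//; last 2 first.
    by apply: integrable_add; exact: Zl.
    exact: integrable_sq_mdist.
  by rewrite RintegralD// ?RintegralZl//; do ?exact: Zl; exact: integrable_sq_mdist.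
rewrite lhsE; set kappa := 1 + K * r ^+ 2.
have rhsE : kappa * (3 + 3 / r * E1 q) * P =
    \int[Q]_x (kappa * P * 3 + kappa * P * (3 / r) * mdist q x).
  rewrite RintegralD//; last 2 first.
    exact: integrable_fun_cst.
    by apply: integrable_scale; exact: integrable_mdist.
  by rewrite Rintegral_probability_cst RintegralZl//; [rewrite /E1; ring | exact: integrable_mdist].
rewrite rhsE; apply: le_Rintegral => //.
- apply: integrable_sub; last exact: integrable_sq_mdist.
  by apply: integrable_add; exact: Zl.
- apply: integrable_add; first exact: integrable_fun_cst.
  by apply: integrable_scale; exact: integrable_mdist.
move=> x _; rewrite /kappa; apply: (le_trans (main x)).
by rewrite le_eqVlt; apply/orP; left; apply/eqP; ring.
Qed.

Lemma frechet_lipschitz (q y : M) :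
  F y - F q <= mdist q y * (2 * E1 q + mdist q y).
Proof.
set d := mdist q y.
have -> : F y - F q = \int[Q]_x (mdist y x ^+ 2 - mdist q x ^+ 2).
  by rewrite RintegralB//; exact: integrable_sq_mdist.
have -> : d * (2 * E1 q + d) = \int[Q]_x (d ^+ 2 + 2 * d * mdist q x).
  rewrite RintegralD//; last 2 first.
    exact: integrable_fun_cst.
    by apply: integrable_scale; exact: integrable_mdist.
  by rewrite Rintegral_probability_cst RintegralZl//; [rewrite /E1; ring | exact: integrable_mdist].
apply: le_Rintegral => //.
- by apply: integrable_sub; exact: integrable_sq_mdist.
- apply: integrable_add; first exact: integrable_fun_cst.
  by apply: integrable_scale; exact: integrable_mdist.
move=> x _; move: (metric_triangle y q x) (mdist_ge0 y x); rewrite (metric_sym y q) -/d.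
move: (mdist y x) (mdist q x) => u v uvd u0.
have : u ^+ 2 <= (d + v) ^+ 2 by rewrite ler_sqr ?nnegrE// (le_trans u0).
lra.
Qed.

End frechet_function.

(** * Steepest directions and first variation *)

Section steepest.
Context {R : realType} {M : metricType R} {q : M}.
Implicit Types (K r C : R) (F : M -> R).

Definition semiconcave_near (r C : R) (F : M -> R) : Prop :=
  forall (a c : M) (g : R -> M) (lam : R),
  mdist q a <= r -> mdist q c <= r ->
  shortest_curve (mdist a c) g -> g 0 = a -> g (mdist a c) = c ->
  0 <= lam <= 1 ->
  (1 - lam) * F a + lam * F c - F (g (lam * mdist a c)) <=
  C * (lam * (1 - lam) * mdist a c ^+ 2).

(** These rates are the numbers below the upper limit of the difference
    quotients of [F] at [q]; arbitrary points converging to [q] are used, so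
    that no directional derivative has to exist beforehand. *)
Definition frequent_slope (F : M -> R) (sigma : R) : Prop :=
  forall rho, 0 < rho -> exists y, [/\ 0 < mdist q y, mdist q y < rho &
    F q + sigma * mdist q y <= F y].

(** By semiconcavity the growth observed at the end of a short shortest curve
    is already present near its starting point. *)
Lemma steep_geodesic (r C : R) (F : M -> R) (sigma sigma' : R) :
  geodesic_space M -> 0 < r -> 0 <= C -> semiconcave_near r C F ->
  frequent_slope F sigma -> sigma' < sigma ->
  exists w : shortest_from q, forall t, 0 <= t <= curve_len w ->
    F q + sigma' * t <= F (w t).
Proof.
move=> geo r0 C0 Fsc freq ss.
have C1 : 0 < C + 1 by rewrite ltr_wpDl.
pose rho := Num.min r ((sigma - sigma') / (C + 1)).
have rho0 : 0 < rho by rewrite lt_min r0 divr_gt0 ?subr_gt0.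
have [y [L0]] := freq rho rho0.
rewrite lt_min => /andP[Lr Ls] Fy.
have [g [gs g0 gL]] := geo q y.
set L := mdist q y in L0 Lr Ls Fy gs gL.
exists (@ShortestFrom R M q g L L0 g0 gs) => t /=; set lam := t / L => /andP[t0 tL].
have tE : t = lam * L by rewrite /lam divfK// gt_eqF.
have l0 : 0 <= lam by rewrite divr_ge0// ltW.
have l1 : lam <= 1 by rewrite ler_pdivrMr// mul1r.
have qq : mdist q q <= r by rewrite mdistxx ltW.
have := Fsc _ _ _ _ qq (ltW Lr) gs g0 gL (introT andP (conj l0 l1)).
rewrite -/L -tE => sc.
have CL : C * L <= sigma - sigma'.
  rewrite ltr_pdivlMr// in Ls; rewrite mulrC; apply: le_trans (ltW Ls).
  by rewrite ler_pM2l// lerDl.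
have h1 : lam * (F q + sigma * L) <= lam * F y by rewrite ler_wpM2l.
have h2 : C * (lam * (1 - lam) * L ^+ 2) <= t * (sigma - sigma').
  have -> : C * (lam * (1 - lam) * L ^+ 2) = t * ((1 - lam) * (C * L)) by rewrite tE; ring.
  by rewrite ler_wpM2l// (le_trans _ CL)// ler_piMl ?gerBl// mulr_ge0// ltW.
have e1 : t * sigma = lam * (sigma * L) by rewrite tE; ring.
lra.
Qed.

(** An upper bound for the distance to [q] of a midpoint, exact in the Euclidean
    plane up to the terms in [K].  Comparison bounds distances from below; the
    prolongation of the ray beyond [w t] turns this into an upper bound. *)
Lemma midpoint_sq_dist_le (K r : R) (w : shortest_from q) (z : M) (g : R -> M) (t : R) :
  almost_euclidean_near q K r -> 0 < t -> 3 * t < r -> 2 * t <= curve_len w -> mdist q z <= t ->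
  shortest_curve (mdist (w t) z) g -> g 0 = w t -> g (mdist (w t) z) = z ->
  mdist q (g (2^-1 * mdist (w t) z)) ^+ 2 <=
    (3 / 2 + 2 * (K * (3 * t) ^+ 2)) * t ^+ 2
    + (3 + K * (3 * t) ^+ 2) / 4 * mdist (w t) z ^+ 2
    - mdist z (w (2 * t)) ^+ 2 / 2.
Proof.
move=> ae t0 tr w2 qz gs g0 gD.
have t20 : 0 <= 2 * t by rewrite mulr_ge0// ltW.
have t2t : t <= 2 * t by rewrite ler_peMl ?ler1n// ltW.
pose y := w t; pose y' := w (2 * t).
have qy : mdist q y = t by rewrite shortest_from_mdist// (ltW t0) (le_trans t2t).
have qy' : mdist q y' = 2 * t by rewrite shortest_from_mdist// w2 t20.
have yy' : mdist y y' = t.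
  rewrite shortest_fromE ?t20 ?(ltW t0) ?(le_trans t2t)//.
  by rewrite ler0_norm ?subr_le0// opprB mulrDl mul1r addrK.
rewrite -/y -/y' in gs g0 gD *; set D := mdist y z in gs gD *.
have D_ge0 : 0 <= D by exact: mdist_ge0.
have D2t : D <= 2 * t.
  have := metric_triangle y q z; rewrite (metric_sym y q) qy -/D; clear -qz; lra.
pose m := g (2^-1 * D); rewrite -/m.
have hD : 2^-1 * D = D / 2 by rewrite mulrC.
have I0 : 0 <= (0 : R) <= D by rewrite lexx.
have ID : 0 <= D <= D by rewrite lexx D_ge0.
have Im : 0 <= 2^-1 * D <= D by rewrite hD; clear -D_ge0; apply/andP; split; lra.
have ym : mdist y m = D / 2.
  rewrite /m -{1}g0 (proj2 gs) ?in_itv// hD sub0r normrN ger0_norm//.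
  by rewrite divr_ge0.
have zm : mdist z m = D / 2.
  rewrite /m -{1}gD (proj2 gs) ?in_itv// hD ger0_norm; clear -D_ge0; lra.
have qm : mdist q m <= 2 * t.
  by have := metric_triangle q y m; rewrite qy ym; clear -D2t; lra.
have zy' : mdist z y' <= 3 * t.
  by have := metric_triangle z q y'; rewrite (metric_sym z q) qy'; clear -qz; lra.
have my' : mdist m y' <= 2 * t.
  by have := metric_triangle m y y'; rewrite (metric_sym m y) ym yy'; clear -D2t; lra.
set e := K * (3 * t) ^+ 2.
have I2 : 0 <= (2^-1 : R) <= 1 by rewrite invr_ge0 invf_le1// ler0n ler1n.
have H2 : 1 - 2^-1 = 2^-1 :> R by field.
have cmp1 : 2^-1 * t ^+ 2 + 2^-1 * mdist z y' ^+ 2 - mdist m y' ^+ 2 <=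
    (1 + e) * (D ^+ 2 / 4).
  have := ae y y' z g 2^-1 (3 * t).
  rewrite -/D -/m yy' (metric_sym y' m) qy qy' H2.
  have -> : 2^-1 * 2^-1 * D ^+ 2 = D ^+ 2 / 4 by field.
  apply => //; clear -t0 tr qz my'; lra.
have cmp2 : 2^-1 * mdist q m ^+ 2 + 2^-1 * mdist m y' ^+ 2 - (D / 2) ^+ 2 <= (1 + e) * t ^+ 2.
  have := @ray_comparison R M q K r w (2 * t) 2^-1 (3 * t) m ae.
  rewrite -/y' (metric_sym y' m) mulKf// -/y ym H2.
  have -> : 2^-1 * 2^-1 * (2 * t) ^+ 2 = t ^+ 2 by field.
  apply => //; clear -t0 tr qm my' D2t; lra.
clear -cmp1 cmp2; lra.
Qed.

(** If [w] is almost a direction of steepest growth of [F] and [F] does not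
    decrease along [u], then [w] and [u] cannot make an angle much greater than
    [pi / 2]: by semiconcavity [F] would grow too fast at midpoints of [w t] and
    [u (c * t)], which are too close to [q]. *)
Lemma steep_acute (K r C : R) (F : M -> R) (w u : shortest_from q) (sigma S c beta : R) :
  0 <= K -> 0 < r -> almost_euclidean_near q K r -> geodesic_space M ->
  0 <= C -> semiconcave_near (r / 6) C F -> (forall y, F q <= F y) ->
  (forall t, 0 <= t <= curve_len w -> F q + sigma * t <= F (w t)) ->
  (exists2 eta, 0 < eta & forall y, mdist q y < eta -> F y <= F q + S * mdist q y) ->
  0 <= S -> 0 < c <= 1 -> 0 <= beta -> beta ^+ 2 = 1 - c ^+ 2 -> S * beta < sigma ->
  - c <= cos (angle w u).
Proof.
move=> K0 r0 ae geo C0 Fsc Fmin Fw [eta eta0 Feta] S0 /andP[c0 c1] beta0 betaE Sb.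
rewrite leNgt; apply/negP => obtuse.
set k := - cos (angle w u).
have kc : c < k by rewrite /k ltrNr.
have k1 : k <= 1 by rewrite /k lerNl cos_geN1.
pose gap := 2 * c * (k - c).
have gap0 : 0 < gap by rewrite !mulr_gt0 ?subr_gt0.
have gap2 : gap <= 2.
  have : c * (k - c) <= 1 * 1 by apply: ler_pM; lra.
  by rewrite /gap; lra.
have [e e0 eE] : exists2 e, 0 < e & e * 10 = gap.
  by exists (gap / 10); rewrite ?divr_gt0// divfK.
have [d1 d10 P1] := rays_mdist K0 r0 ae w u ltr01 c0 e0.
have [d2 d20 P2] := rays_mdist K0 r0 ae w u (ltr0n R 2) c0 e0.
have [D0 D0p D0E] : exists2 D0, 0 < D0 & D0 = sigma - S * beta.
  by exists (sigma - S * beta); rewrite ?subr_gt0.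
(* Below [T] all points stay in the range of comparison, the curvature error is
   at most [e / 20], and the quadratic error of semiconcavity cannot absorb the
   excess [D0] of the growth rate. *)
pose T := Num.min (Num.min d1 d2) (Num.min (Num.min (r / 12) (eta / 3))
   (Num.min (e / (200 * (K + 1))) (Num.min 1 (D0 / (5 * (C + 1)))))).
have K1 : 0 < K + 1 by rewrite ltr_wpDl.
have C1 : 0 < C + 1 by rewrite ltr_wpDl.
have T0 : 0 < T by rewrite !lt_min d10 d20 ltr01 !divr_gt0 ?mulr_gt0.
have [t t0 tT] : exists2 t, 0 < t & t < T.
  by exists (T / 2); rewrite ?divr_gt0// ltr_pdivrMr// ltr_pMr// ltr1n.
move: tT; rewrite !lt_min => /andP[/andP[t1 t2] /andP[/andP[tr teta] /and3P[tK tt1 tD]]].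
have [|w1 uc E1] := P1 t; first by rewrite t0.
have [|w2 _ E2] := P2 t; first by rewrite t0.
rewrite mul1r in w1 E1.
pose y := w t; pose y' := w (2 * t); pose z := u (c * t).
rewrite -/y -/z -/y' in E1 E2.
have ctt : c * t <= t by rewrite ler_piMl// ltW.
have qy : mdist q y = t by rewrite shortest_from_mdist// ltW.
have qz : mdist q z = c * t by rewrite shortest_from_mdist// uc mulr_ge0// ltW.
have qzt : mdist q z <= t by rewrite qz.
have [g [gs g0 gD]] := geo y z.
have t3r : 3 * t < r by clear -tr t0; lra.
have mid := midpoint_sq_dist_le ae t0 t3r w2 qzt gs g0 gD.
rewrite -/y -/y' in mid.
set D := mdist y z in E1 gs gD mid.
have D_ge0 : 0 <= D by exact: mdist_ge0.
have D2t : D <= 2 * t.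
  by have := metric_triangle y q z; rewrite (metric_sym y q) qy -/D; clear -qzt; lra.
pose m := g (2^-1 * D); rewrite -/m in mid.
set e' := K * (3 * t) ^+ 2 in mid.
have e'0 : 0 <= e' by rewrite mulr_ge0// sqr_ge0.
have e'e : e' <= e / 20.
  have tK' : K * t <= e / 200.
    rewrite ltr_pdivlMr ?mulr_gt0// in tK.
    by clear -tK t0; lra.
  have -> : e' = 9 * (K * t) * t by rewrite /e'; ring.
  have Kt : K * t * t <= K * t by rewrite ler_piMr ?mulr_ge0 ?(ltW t0)// ltW.
  by clear -Kt tK' e0; lra.
have t20 : 0 < t ^+ 2 by rewrite exprn_gt0.
(* To first order the midpoint is as close to [q] as in the Euclidean cone. *)
have near_q : mdist q m ^+ 2 <= (beta / 2 * t) ^+ 2.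
  have kE : cos (angle w u) = - k by rewrite /k opprK.
  rewrite kE (metric_sym y' z) in E1 E2.
  move: E1 E2; rewrite !ler_norml => /andP[_ E1] /andP[E2 _].
  have De : e' * D ^+ 2 <= e' * (4 * t ^+ 2).
    rewrite ler_wpM2l//; have -> : 4 * t ^+ 2 = (2 * t) ^+ 2 by ring.
    by rewrite ler_sqr ?nnegrE// mulr_ge0// ltW.
  have e't : e' * t ^+ 2 <= e / 20 * t ^+ 2 by rewrite ler_pM2r.
  rewrite exprMn expr_div_n betaE.
  have et2 : e * 10 * t ^+ 2 = 2 * c * (k - c) * t ^+ 2 by rewrite eE.
  have et0 : 0 <= e * t ^+ 2 by rewrite mulr_ge0// ltW.
  by clear -mid E1 E2 De e't et2 et0; lra.
have qmt : mdist q m <= beta / 2 * t.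
  rewrite -ler_sqr ?nnegrE ?mdist_ge0//.
  by rewrite mulr_ge0 ?divr_ge0// ltW.
have yr : mdist q y <= r / 6 by rewrite qy; clear -tr t0; lra.
have zr : mdist q z <= r / 6 by rewrite (le_trans qzt)// -qy.
have I2 : 0 <= (2^-1 : R) <= 1 by rewrite invr_ge0 invf_le1// ler0n ler1n.
have := Fsc _ _ _ _ yr zr gs g0 gD I2; rewrite -/D -/m => sc.
have Fy : F q + sigma * t <= F y by apply: Fw; rewrite w1 ltW.
have Fm : F m <= F q + S * (beta / 2 * t).
  have bt : beta / 2 * t <= 2^-1 * t.
    rewrite ler_pM2r// mulrC ler_piMr ?invr_ge0//.
    by rewrite -(@ler_pXn2r _ 2)// ?nnegrE// betaE expr1n gerBl sqr_ge0.
  apply: (le_trans (Feta m _)); first by clear -qmt bt teta t0; lra.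
  by rewrite lerD2l ler_wpM2l.
have CD : C * D ^+ 2 <= C * (2 * t) ^+ 2.
  by rewrite ler_wpM2l// ler_sqr ?nnegrE// mulr_ge0// ltW.
have Fz := Fmin z.
have tD2 : (5 * (C + 1) * t) * t < D0 * t.
  by rewrite ltr_pM2r// mulrC -ltr_pdivlMr// mulr_gt0.
have D0t : D0 * t = sigma * t - S * beta * t by rewrite D0E; ring.
have Ct2 : 0 <= C * t ^+ 2 by rewrite mulr_ge0// ltW.
by clear -sc Fy Fm CD Fz tD2 D0t Ct2 t20; lra.
Qed.

End steepest.

Section first_variation.
Context {R : realType} {M : metricType R} {q : M}.

(** Comparison is made with the point [u (N * t)] close to [q] only; the rest of
    [u] is accounted for by the triangle inequality. *)
Lemma first_variation (K r : R) (w u : shortest_from q) (c : R) :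
  0 <= K -> 0 < r -> almost_euclidean_near q K r -> 0 < c -> - c <= cos (angle w u) ->
  exists2 d, 0 < d & forall t, 0 < t < d ->
    t <= curve_len w /\ mdist (w t) (u (curve_len u)) <= curve_len u + 2 * c * t.
Proof.
move=> K0 r0 ae c0 acute; pose N := c^-1.
have N0 : 0 < N by rewrite invr_gt0.
have [d d0 dP] := rays_mdist K0 r0 ae w u ltr01 N0 ltr01.
(* The Euclidean hinge with sides [N * t] and [t] has third side less
   than [(N + 2 * c) * t], since [N * c = 1]. *)
exists d => // t td; have [wt ut b] := dP t td.
have /andP[t0 _] := td.
rewrite mul1r in wt b; split => //.
have u0 := curve_len_gt0 u; set l := curve_len u in u0 ut *.
have Nt0 : 0 < N * t by rewrite mulr_gt0.
have ul : mdist (u (N * t)) (u l) = l - N * t.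
  rewrite shortest_fromE ?(ltW Nt0) ?lexx ?(ltW u0)//.
  by rewrite distrC ger0_norm ?subr_ge0.
have tri := metric_triangle (w t) (u (N * t)) (u l).
suff near : mdist (w t) (u (N * t)) <= (N + 2 * c) * t by rewrite ul in tri; lra.
have t20 : 0 < t ^+ 2 by rewrite exprn_gt0.
have Nc0 : 0 <= N + 2 * c by lra.
rewrite -ler_sqr ?nnegrE ?mdist_ge0 ?(mulr_ge0 Nc0 (ltW t0))//.
move: b; rewrite ler_norml => /andP[_].
rewrite lerBlDr => /le_trans; apply; rewrite exprMn -mulrDl ler_pM2r//.
have Nc : N * c = 1 by rewrite mulVf// gt_eqF.
have : N * - c <= N * cos (angle w u) by rewrite ler_pM2l.
have := sqr_ge0 c.
lra.
Qed.

End first_variation.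

Section frechet_first_variation.
Context {R : realType} {M : completeMetricType R} (Q : probability (borel M) R).
Hypothesis fsm : finite_second_moment Q.

(** Pointwise bounds on the growth of the squared distances along a curve can be
    integrated by dominated convergence, the difference quotients being bounded
    by an affine function of the distance. *)
Lemma frechet_growth_le (q : M) (w : shortest_from q) (c e rho : R) :
  0 < c -> 0 < e -> 0 < rho ->
  (forall x, exists2 d, 0 < d & forall t, 0 < t < d ->
     mdist (w t) x ^+ 2 - mdist q x ^+ 2
       <= (4 * c * mdist q x + (4 * c ^+ 2 + 1) * t) * t) ->
  exists t, [/\ 0 < t, t < rho, t <= curve_len w &
    frechet_function Q (w t) - frechet_function Q q
      <= (4 * c * (\int[Q]_x mdist q x) + e) * t].
Proof.
move=> c0 e0 rho0 grow.
pose s := Num.min rho (Num.min (curve_len w) 1).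
have s0 : 0 < s by rewrite !lt_min rho0 ltr01 curve_len_gt0.
pose t n : R := s * n.+2%:R^-1.
have t0 n : 0 < t n by rewrite mulr_gt0 ?invr_gt0.
have ts n : t n < s by rewrite gtr_pMr// invf_lt1// ltr1n.
have trho n : t n < rho by rewrite (lt_le_trans (ts n))// ge_min lexx.
have tw n : t n <= curve_len w.
  by rewrite ltW// (lt_le_trans (ts n))// !ge_min lexx orbT.
have t1 n : t n <= 1 by rewrite ltW// (lt_le_trans (ts n))// !ge_min lexx !orbT.
have tcvg : t n @[n --> \oo] --> (0 : R).
  rewrite -[X in _ --> X](mulr0 s); apply: cvgM; first exact: cvg_cst.
  have := @cvg_harmonic R; rewrite -(cvg_shiftS _ _).
  exact.
pose f n (x : borel M) : R := (mdist (w (t n)) x ^+ 2 - mdist q x ^+ 2) / t n - 4 * c * mdist q x.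
pose phi n (x : borel M) : R := Num.max (f n x) 0.
have mf n : measurable_fun setT (f n).
  apply: measurable_funB; last by apply: measurable_funM => //; exact: measurable_mdist.
  apply: measurable_funM => //.
  by apply: measurable_funB; exact: measurable_sq_mdist.
have mphi n : measurable_fun setT (phi n) by apply: measurable_maxr.
have fle n x : f n x <= 2 * mdist q x + 1.
  have qw : mdist q (w (t n)) = t n by rewrite shortest_from_mdist// tw ltW.
  have := metric_triangle (w (t n)) q x; rewrite (metric_sym _ q) qw.
  have := mdist_ge0 (w (t n)) x; have := mdist_ge0 q x.
  rewrite /f; move: (mdist _ x) (mdist q x) => u v v0 u0 uv.
  have : (u ^+ 2 - v ^+ 2) / t n <= 2 * v + 1.
    rewrite ler_pdivrMr//.
    have : u ^+ 2 <= (t n + v) ^+ 2 by rewrite ler_sqr ?nnegrE// (le_trans u0).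
    have : t n * t n <= 1 * t n by rewrite ler_pM2r.
    lra.
  have : 0 <= c * v by rewrite mulr_ge0// ltW.
  lra.
have phi_le n x : `|phi n x| <= 2 * mdist q x + 1.
  rewrite ger0_norm ?le_max ?lexx ?orbT// ge_max fle/=.
  by rewrite addr_ge0// mulr_ge0// mdist_ge0.
have phi0 x : phi n x @[n --> \oo] --> (0 : R).
  have [d d0 dP] := grow x.
  have Ct : (4 * c ^+ 2 + 1) * t n @[n --> \oo] --> (0 : R).
    by rewrite -[X in _ --> X](mulr0 (4 * c ^+ 2 + 1)); apply: cvgM => //; exact: cvg_cst.
  apply: (squeeze_cvgr _ (cvg_cst 0) Ct); near=> n.
  rewrite le_max lexx orbT/= ge_max; apply/andP; split; last first.
    by rewrite mulr_ge0 ?(ltW (t0 n))// addr_ge0// mulr_ge0// sqr_ge0.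
  rewrite /f lerBlDr ler_pdivrMr// [X in _ <= X * _]addrC.
  apply: dP; rewrite t0/=; near: n.
  by apply: (cvgr_lt 0) => //.
have igq : Q.-integrable setT (EFin \o (fun x : borel M => 2 * mdist q x + 1)).
  apply: integrable_add; last exact: integrable_fun_cst.
  by apply: integrable_scale; exact: integrable_mdist.
have iphi n : Q.-integrable setT (EFin \o phi n).
  apply: le_integrable igq => //; first exact/measurable_EFinP.
  move=> x _ /=; rewrite lee_fin (le_trans (phi_le n x))//; exact: ler_norm.
have mphiE n : measurable_fun setT (EFin \o phi n) by exact/measurable_EFinP.
have phi0E : {ae Q, forall x, setT x -> (EFin \o phi n) x @[n --> \oo] --> cst 0%E x}.
  by apply: aeW => x _; apply: cvg_EFin; [exact: nearW | exact: phi0].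
have phi_leE : {ae Q, forall (x : borel M) n, setT x ->
    (`|(EFin \o phi n) x| <= (EFin \o (fun x : borel M => 2 * mdist q x + 1)%R) x)%E}.
  by apply: aeW => x n _ /=; rewrite lee_fin.
have [_ _ dct] := dominated_convergence measurableT mphiE (measurable_cst _) phi0E igq phi_leE.
rewrite integral0 in dct.
have [N _ HN] : \forall n \near \oo, \int[Q]_x phi n x < e.
  have /fine_cvgP[_] := dct.
  by move=> /cvgr_lt/(_ _ e0); apply: filterS.
have {HN}IN := HN N (leqnn N).
exists (t N); split; [exact: t0|exact: trho|exact: tw|].
set u := w (t N).
have -> : frechet_function Q u - frechet_function Q q =
    \int[Q]_x (mdist u x ^+ 2 - mdist q x ^+ 2).
  by rewrite RintegralB//; exact: integrable_sq_mdist.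
have i4 : Q.-integrable setT (EFin \o (fun x : borel M => 4 * c * mdist q x)).
  by apply: integrable_scale; exact: integrable_mdist.
apply: (@le_trans _ _ (\int[Q]_x (t N * (4 * c * mdist q x + phi N x)))).
  apply: le_Rintegral => //.
  - by apply: integrable_sub; exact: integrable_sq_mdist.
  - by apply: integrable_scale; exact: integrable_add.
  move=> x _; rewrite mulrC -ler_pdivrMr//.
  have : f N x <= phi N x by rewrite le_max lexx.
  rewrite /f -/u; lra.
rewrite RintegralZl//; last exact: integrable_add.
rewrite RintegralD// RintegralZl//; last exact: integrable_mdist.
by rewrite mulrC ler_pM2r// lerD2l ltW.
Unshelve. all: by end_near. Qed.

End frechet_first_variation.

(** * The Frechet mean is a critical point *)

Section critical_point.
Context {R : realType} {M : completeMetricType R} (Q : probability (borel M) R).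
Hypotheses (aM : alexandrov_space M) (fsm : finite_second_moment Q).
Variables (mu : M).
Hypothesis mean : frechet_mean Q mu.

Let F := frechet_function Q.

Let geo : geodesic_space M.
Proof. by move=> x y; have [lenM dimM _] := aM; exact: shortest_curve_exists. Qed.

Lemma frechet_mean_no_slope (e : R) : 0 < e -> ~ frequent_slope (q := mu) F e.
Proof.
move=> e0 freq_e.
have [_ _ [k curv]] := aM.
have [K [r [K0 r0 ae]]] := curvature_ge_almost_euclidean mu curv.
pose E1 := \int[Q]_x mdist mu x.
have E10 : 0 <= E1 by apply: Rintegral_ge0 => x _; exact: mdist_ge0.
pose Slopes := [set s | frequent_slope (q := mu) F s].
have hS : has_sup Slopes.
  split; first by exists e.
  exists (2 * E1 + 1) => s /(_ 1 ltr01)[y [y0 y1 Fy]].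
  have := frechet_lipschitz fsm mu y; rewrite -/F -/E1 => lip.
  have : mdist mu y * s <= mdist mu y * (2 * E1 + mdist mu y) by lra.
  rewrite ler_pM2l//; lra.
pose s := sup Slopes.
have es : e <= s by apply: ub_le_sup => //; exact: hS.2.
have s0 : 0 < s by exact: lt_le_trans es.
have E11 : 0 < 16 * (E1 + 1) by rewrite mulr_gt0// ltr_wpDl.
(* The growth rate along the chosen curve will be at most [4 * c * E1 + s / 8],
   which this choice of [c] keeps below [s / 2]. *)
pose c := Num.min 1 (s / (16 * (E1 + 1))).
have c0 : 0 < c by rewrite lt_min ltr01 divr_gt0.
have c1 : c <= 1 by rewrite ge_min lexx.
have cE : c * (16 * (E1 + 1)) <= s by rewrite -ler_pdivlMr// ge_min lexx orbT.
clearbody c.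
pose beta := Num.sqrt (1 - c ^+ 2).
have c2 : c ^+ 2 <= 1 by rewrite expr_le1// ltW.
have beta0 : 0 <= beta by exact: sqrtr_ge0.
have betaE : beta ^+ 2 = 1 - c ^+ 2 by rewrite sqr_sqrtr// subr_ge0.
have beta1 : beta < 1.
  by rewrite -(@ltr_pXn2r _ 2)// ?nnegrE// betaE expr1n gtrBl exprn_gt0.
have [d d0 d4] : exists2 d, 0 < d & d * 4 = s - s * beta.
  exists (s * (1 - beta) / 4); first by rewrite divr_gt0// mulr_gt0// subr_gt0.
  by rewrite divfK// mulrBr mulr1.
have [sigma freq_sigma sigma_s] := sup_adherent d0 hS.
pose C := (1 + K * r ^+ 2) * (3 + 3 / r * E1).
have C0 : 0 <= C.
  have r3 : 0 <= 3 / r by rewrite divr_ge0// ltW.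
  by rewrite /C mulr_ge0 ?addr_ge0 ?(mulr_ge0 K0 (sqr_ge0 r)) ?(mulr_ge0 r3 E10).
have Fsc : semiconcave_near (q := mu) (r / 6) C F.
  by move=> *; exact: frechet_semiconcave.
have [w Fw] : exists w : shortest_from mu, forall t, 0 <= t <= curve_len w ->
    F mu + (s - 2 * d) * t <= F (w t).
  have r6 : 0 < r / 6 by rewrite divr_gt0.
  by apply: (steep_geodesic geo r6 C0 Fsc freq_sigma); rewrite -/s in sigma_s; lra.
have upper : exists2 eta, 0 < eta &
    forall y, mdist mu y < eta -> F y <= F mu + (s + d) * mdist mu y.
  have /existsNP[eta /not_implyP[eta0 noy]] : ~ frequent_slope (q := mu) F (s + d).
    move=> freq; have : s + d <= s by apply: ub_le_sup => //; exact: hS.2.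
    by rewrite gerDl leNgt d0.
  exists eta => // y ye; have [->|ymu] := eqVneq y mu; first by rewrite mdistxx mulr0 addr0.
  rewrite leNgt; apply/negP => Fy; apply: noy; exists y; split => //; last exact: ltW.
  by rewrite mdist_gt0 eq_sym.
have acute (u : shortest_from mu) : - c <= cos (angle w u).
  apply: (@steep_acute R M mu K r C F w u _ _ c beta
    K0 r0 ae geo C0 Fsc mean Fw upper _ _ beta0 betaE).
  - by rewrite addr_ge0 ?ltW.
  - by rewrite c0.
  - have : d * beta <= d by rewrite ler_piMr// ltW.
    lra.
have grow x : exists2 d', 0 < d' & forall t, 0 < t < d' ->
     mdist (w t) x ^+ 2 - mdist mu x ^+ 2
       <= (4 * c * mdist mu x + (4 * c ^+ 2 + 1) * t) * t.
  have [->|xmu] := eqVneq x mu.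
    exists (curve_len w); first exact: curve_len_gt0.
    move=> t /andP[t0 tl]; rewrite mdistxx (metric_sym _ mu) shortest_from_mdist ?(ltW t0) ?(ltW tl)//.
    have : 0 <= c ^+ 2 * t ^+ 2 by rewrite mulr_ge0 ?sqr_ge0.
    lra.
  have l0 : 0 < mdist mu x by rewrite mdist_gt0 eq_sym.
  have [g [gs g0 gl]] := geo mu x.
  pose u := ShortestFrom l0 g0 gs.
  have [d' d'0 d'P] := first_variation K0 r0 ae c0 (acute u).
  exists d' => // t td'; have [_] := d'P t td'.
  rewrite /= gl => near; have /andP[t0 _] := td'.
  have : mdist (w t) x ^+ 2 <= (mdist mu x + 2 * c * t) ^+ 2.
    by rewrite ler_sqr ?nnegrE ?mdist_ge0// (le_trans _ near)// mdist_ge0.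
  have := sqr_ge0 t; lra.
have s8 : 0 < s / 8 by rewrite divr_gt0.
have [t [t0 _ tw Ft]] := frechet_growth_le fsm c0 s8 ltr01 grow.
have : F mu + (s - 2 * d) * t <= F (w t) by apply: Fw; rewrite ltW.
rewrite -/F -/E1 in Ft => Fwt.
have : (s - 2 * d) * t <= (4 * c * E1 + s / 8) * t by lra.
rewrite ler_pM2r//.
have : 0 <= s * beta by rewrite mulr_ge0// ltW.
lra.
Qed.

End critical_point.

Theorem theorem7p4 (R : realType) (M : completeMetricType R)
    (d : measure_display) (Omega : measurableType d) (P : probability Omega R)
    (X : {RV P >-> borel M}) (mu : M) :
  alexandrov_space M ->
  finite_second_moment (distribution P X) ->
  frechet_mean (distribution P X) mu ->
  is_differential (frechet_function (distribution P X))
    (fun _ : tangent_cone mu => 0).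
Proof.
set Q := distribution P X; set F := frechet_function Q => aM fsm mean.
have deriv0 (g : shortest_from mu) : (F (g t) - F mu) / t @[t --> 0^'+] --> (0 : R).
  apply/cvgrPdist_lt => e e0.
  have /existsNP[rho /not_implyP[rho0 flat]] := frechet_mean_no_slope aM fsm mean e0.
  near=> t; have t0 : 0 < t by near: t; exact: nbhs_right_gt.
  have tg : t <= curve_len g by near: t; apply: nbhs_right_le; exact: curve_len_gt0.
  have trho : t < rho by near: t; exact: nbhs_right_lt.
  have gt : mdist mu (g t) = t by rewrite shortest_from_mdist// ltW.
  rewrite sub0r normrN ger0_norm; last by rewrite divr_ge0 ?subr_ge0 ?(ltW t0)//; exact: mean.
  rewrite ltr_pdivrMr// ltrBlDl ltNge; apply/negP => Fgt.
  by apply: flat; exists (g t); rewrite gt.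
split.
  split=> [v e e0|l v|g].
  - by exists 1 => // w _; rewrite subrr normr0.
  - by rewrite mulr0.
  - exact: deriv0.
move=> D [Dc Dh Dg]; apply/funext => v; apply/esym.
have [_ _ [k curv]] := aM.
have [K [r [K0 r0 ae]]] := curvature_ge_almost_euclidean mu curv.
apply: (differential_eq0 K0 r0 ae Dc Dh) => g.
exact: (cvg_unique _ (Dg g) (deriv0 g)).
Unshelve. all: by end_near. Qed.
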